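(* Let $n\ge1$. For Lebesgue-almost every $\boldsymbol\alpha\in\mathbb R^n$ and all $\boldsymbol T=(T_1,\dots,T_n)\in[1,+\infty)^n$, $$S(\boldsymbol\alpha,\boldsymbol T)\asymp_{\boldsymbol\alpha,n}\log\bar T\,\log T_1\cdots\log T_n,\qquad \bar T:=(T_1\cdots T_n)^{1/n}.$$ Moreover, for Lebesgue-almost every $\boldsymbol\alpha\in\mathbb R^n$ and all $T\ge1$, $$S^*(\boldsymbol\alpha,T)\asymp_{\boldsymbol\alpha,n}(\log T)^{n+1}.$$
   Context: For $x\in\mathbb R$, $\|x\|$ is the distance from $x$ to the nearest integer, $x^+:=\max\{1,x\}$, and throughout $\log x$ stands for $\log\max\{x,e\}$. For $\boldsymbol\alpha\in\mathbb R^n$, $\boldsymbol T\in[1,\infty)^n$, $T\ge1$: $$S(\boldsymbol\alpha,\boldsymbol T):=\sum_{\substack{\boldsymbol q\in\mathbb Z^n\setminus\{\boldsymbol 0\}\\ 0\le q_i\le T_i}}\frac{1}{q_1^+\cdots q_n^+\,\|\boldsymbol q\cdot\boldsymbol\alpha\|},\qquad S^*(\boldsymbol\alpha,T):=\sum_{q\in\mathbb Z,\ 0<q\le T}\frac{1}{q\,\|q\alpha_1\|\cdots\|q\alpha_n\|},$$ where $\boldsymbol q\cdot\boldsymbol\alpha$ is the dot product. $X\asymp_z Y$ means $X\ll_z Y$ and $Y\ll_z X$, with implied constants depending only on $z$. *)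

(* Defs.v *)
From HB Require Import structures.
From mathcomp Require Import all_boot all_order all_algebra.
From mathcomp Require Import all_classical all_reals all_analysis.
Set Implicit Arguments. Unset Strict Implicit. Unset Printing Implicit Defensive.
Import Order.TTheory GRing.Theory Num.Theory.
Local Open Scope classical_set_scope.
Local Open Scope ring_scope.

Section Defs.
Variable R : realType.

Definition distZ (x : R) : R :=
  Num.min (x - (Num.floor x)%:~R) ((Num.floor x + 1)%:~R - x).

Definition pos1 (x : R) : R := Num.max 1 x.

(* the paper's convention: log x := log max{x, e} *)
Definition logm (x : R) : R := ln (Num.max x (expR 1)).

Definition lebesgue_null (n : nat) (A : set ('I_n -> R)) : Prop :=
  forall eps : R, 0 < eps ->
    exists a b : nat -> 'I_n -> R,
      (forall k i, a k i <= b k i) /\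
      (forall x, A x -> exists k, forall i, a k i <= x i <= b k i) /\
      (forall N, \sum_(k < N) \prod_(i < n) (b k i - a k i) < eps).

Definition ae_Rn (n : nat) (P : ('I_n -> R) -> Prop) : Prop :=
  lebesgue_null [set x | ~ P x].

(* S(alpha, T): sum over q in Z^n \ {0} with 0 <= q_i <= T_i.
   q is encoded as a finite function into 'I_(M+1) with M >= every T_i. *)
Definition Ssum (n : nat) (alpha T : 'I_n -> R) : R :=
  let M := (\max_(i < n) Num.truncn (T i))%N in
  \sum_(q : {ffun 'I_n -> 'I_M.+1} |
          [exists i, (q i != 0%N :> nat)] && [forall i, ((q i)%:R <= T i)])
     1 / ((\prod_(i < n) pos1 (q i)%:R) *
          distZ (\sum_(i < n) (q i)%:R * alpha i)).

Definition Sstar (n : nat) (alpha : 'I_n -> R) (T : R) : R :=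
  \sum_(1 <= q < (Num.truncn T).+1)
     1 / (q%:R * \prod_(i < n) distZ (q%:R * alpha i)).

Definition asymp_unif (I : Type) (D : I -> Prop) (X Y : I -> R) : Prop :=
  exists C : R, 0 < C /\ forall t, D t -> X t <= C * Y t /\ Y t <= C * X t.

End Defs.

(* Main.v *)
(* First moments of Fejer kernels F_M, combined with duality.  Up to constants
   1 / ||x|| is the sum of F_{2^j}(x) over the j with 2^-j >= ||x||, so both sums
   split into dyadic pieces indexed by (l, j), where q_i ~ 2^{l_i} and the
   distances are ~ 2^{-j_k}.  For a real matrix A with linear forms psi and
   transposed forms phi, expanding the kernels gives
     sum_q w_L(q) prod_k F_{M_k}(psi_k(q)) = sum_m w_M(m) prod_i F_{L_i}(phi_i(m)).
   On the right, m = 0 is the expected main term prod_i L_i, and the other terms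
   are nonnegative of total mean at most prod_k M_k.  Hence, with |l| = sum_i l_i:
   pieces with |j| <= |l| deviate little from the main term on average; a piece
   with |j| > |l| has bounded mean; and pieces with |j| much larger than |l| do
   not occur for almost every A.  After weighting by prod_i 1 / (1 + l_i) the
   total mean of all the l < 4^s is a polynomial in s times 2^-s, so
   Borel-Cantelli controls all T at once.  S and S^* are the cases of a single
   column and of a single row. *)
Require Import Defs.
From HB Require Import structures.
From mathcomp Require Import all_boot all_order all_algebra.
From mathcomp Require Import all_classical all_reals all_analysis.
From mathcomp Require Import complex ring lra zify.
Set Implicit Arguments. Unset Strict Implicit. Unset Printing Implicit Defensive.
Import Order.TTheory GRing.Theory Num.Theory.
Import numFieldNormedType.Exports.
Local Open Scope ring_scope.

(** * The Fejer kernel *)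

Section Fejer.
Variable R : realType.
Local Open Scope complex_scope.

(** The obstacle is that [1 / ||x||] is not integrable: the sums themselves have infinite mean, and
    only truncated dyadic pieces can be averaged. One quantity, [total], does two jobs. Its
    smallness bounds the deviations from the main terms, and since its pieces reach slightly past
    [|j| = |l|], it also excludes every piece further out. With [N = 4^s] and [|l|] of order [N],
    there are about [N^(r+1)] main terms for each [l], whereas the mean deviation decays like
    [2^-(|l| - |j|)] and is carried by few diagonals of order [N^r] points each. The factor [N]
    gained, up to powers of [s], is split evenly: one [2^s] makes the exceptional sets summable, the
    other makes deviations negligible. The weights [1 / (1 + l_i)] are there because the [T_i] may
    have very different sizes: they bound deviations in terms of the product of the [log T_i]
    instead of [N^(p+1)], at the cost of a power of [s]. Means are taken over finite grids, where
    they are exact, so no integral occurs. *)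

Definition ee (x : R) : R[i] := cos (2 * pi * x) +i* sin (2 * pi * x).

Lemma ee0 : ee 0 = 1.
Proof. by rewrite /ee mulr0 cos0 sin0. Qed.

Lemma eeD x y : ee (x + y) = ee x * ee y.
Proof.
rewrite /ee mulrDr cosD sinD; apply/eqP; rewrite eq_complex /=.
by rewrite eqxx /= addrC.
Qed.

Lemma eeN x : ee (- x) = conjc (ee x).
Proof. by rewrite /ee mulrN cosN sinN. Qed.

Lemma ee_sum (J : Type) (s : seq J) (P : pred J) (F : J -> R) :
  ee (\sum_(i <- s | P i) F i) = \prod_(i <- s | P i) ee (F i).
Proof. exact: (big_morph ee eeD ee0). Qed.

Lemma ee_nat (m : nat) : ee m%:R = 1.
Proof.
elim: m => [|m IH]; first exact: ee0.
rewrite -natr1 eeD IH mul1r /ee mulr1 mulrC mulr_natr cos2pi sin2pi.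
by apply/eqP; rewrite eq_complex /= !eqxx.
Qed.

Lemma ee_int (m : int) : ee m%:~R = 1.
Proof.
case: m => m; first exact: ee_nat.
by rewrite NegzE rmorphN /= eeN -pmulrn ee_nat conjc1.
Qed.

Lemma ee_mulrn x n : ee (n%:R * x) = ee x ^+ n.
Proof.
elim: n => [|n IH]; first by rewrite mul0r ee0 expr0.
by rewrite -natr1 mulrDl mul1r eeD IH exprSr.
Qed.

Lemma ee_eq1 (x : R) : 0 < `|x| < 1 -> ee x != 1.
Proof.
move=> /andP[x0 x1]; apply/eqP => -[] hc _.
have h : sin (pi * `|x|) = 0.
  apply/eqP; rewrite -sqrf_eq0 sin2cos2.
  have : cos (2 * pi * `|x|) = 1.
    by rewrite -[RHS]hc -[RHS]cos_norm normrM (@ger0_norm _ (2 * pi)) // mulr_ge0 ?pi_ge0.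
  have -> : 2 * pi * `|x| = (pi * `|x|) *+ 2 :> R by rewrite -mulrA mulr_natl.
  rewrite cos_mulr2n => hh; apply/eqP; lra.
have : 0 < sin (pi * `|x|).
  apply: sin_gt0_pi; rewrite mulr_gt0 ?pi_gt0 //=.
  by rewrite -[X in _ < X]mulr1 ltr_pM2l ?pi_gt0.
by rewrite h ltxx.
Qed.

(** This is [|e(0) + e(x) + ... + e((L-1)x)|^2 / L] in real coordinates, which makes non-negativity
    immediate. *)
Definition fejer (L : nat) (x : R) : R :=
  ((\sum_(a < L) cos (2 * pi * (a%:R * x))) ^+ 2
   + (\sum_(a < L) sin (2 * pi * (a%:R * x))) ^+ 2) / L%:R.

Lemma fejer_ge0 L x : 0 <= fejer L x.
Proof. by rewrite divr_ge0 ?addr_ge0 ?sqr_ge0 ?ler0n. Qed.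

Lemma sum_complex (J : Type) (s : seq J) (P : pred J) (F G : J -> R) :
  \sum_(i <- s | P i) (F i +i* G i)
  = (\sum_(i <- s | P i) F i) +i* (\sum_(i <- s | P i) G i).
Proof.
elim: s => [|a s IH]; first by rewrite !big_nil.
by rewrite !big_cons; case: (P a) => //; rewrite IH.
Qed.

Lemma fejer_ee L x :
  (fejer L x)%:C
  = (L%:R^-1)%:C * \sum_(a < L) \sum_(b < L) ee ((a%:R - b%:R) * x).
Proof.
have -> : \sum_(a < L) \sum_(b < L) ee ((a%:R - b%:R) * x)
   = (\sum_(a < L) ee (a%:R * x)) * conjc (\sum_(a < L) ee (a%:R * x)).
  rewrite mulr_suml; apply: eq_bigr => a _.
  rewrite raddf_sum mulr_sumr; apply: eq_bigr => b _.
  by rewrite mulrBl eeD eeN.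
rewrite sum_complex /fejer.
set c := \sum_(_ < _) _; set s := \sum_(_ < _) _.
by apply/eqP; rewrite eq_complex /=; apply/andP; split; apply/eqP; ring.
Qed.

(** Enumerates the integers from [-N] to [N - 1] by a finite type. One [N] serves all kernels of
    order [L <= N] at once, since truncated subtraction makes [tri L r] vanish for [|r| >= L]. *)
Definition zi (N : nat) (u : bool * 'I_N) : int :=
  if u.1 then Negz u.2 else Posz u.2.

Lemma zi_inj N : injective (@zi N).
Proof.
move=> [[] a] [[] b] //= [] h; congr (_, _); exact: val_inj.
Qed.

Definition tri (L : nat) (r : int) : R := (L - `|r|)%N%:R / L%:R.

Lemma tri_ge0 L r : 0 <= tri L r.
Proof. by rewrite divr_ge0 ?ler0n. Qed.

Lemma tri_le1 L r : tri L r <= 1.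
Proof.
rewrite /tri; case: L => [|L]; first by rewrite sub0n mul0r.
by rewrite ler_pdivrMr ?ltr0n // mul1r ler_nat leq_subr.
Qed.

Lemma tri0 L : (0 < L)%N -> tri L 0 = 1.
Proof. by move=> L0; rewrite /tri subn0 divff // pnatr_eq0 -lt0n. Qed.

Lemma tri_gt0 L r : 0 < tri L r -> (`|r| < L)%N.
Proof.
apply: contraTT; rewrite -leqNgt => h; rewrite /tri.
by move: h; rewrite -subn_eq0 => /eqP ->; rewrite mul0r ltxx.
Qed.

Lemma tri_half L r : (0 < L)%N -> (2 * `|r| <= L)%N -> 2^-1 <= tri L r.
Proof.
move=> L0 h; rewrite /tri ler_pdivlMr ?ltr0n // mulrC ler_pdivrMr ?ltr0n //.
by rewrite -natrM ler_nat; lia.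
Qed.

(** The difference [z] arises from [L - |z|] pairs. In the induction the new index adds a column
    with the differences [-1, ..., -L] ([E1]) and a row with the differences [0, ..., L] ([E2]). *)
Lemma sum_diff (V : nmodType) (g : int -> V) (L N : nat) : (L <= N)%N ->
  \sum_(a < L) \sum_(b < L) g (a%:Z - b%:Z)
  = \sum_(u : bool * 'I_N) g (zi u) *+ (L - `|zi u|).
Proof.
move=> LN; rewrite (eq_bigr (fun u => (fun b i => g (@zi N (b, i)) *+ (L - `|@zi N (b, i)|)) u.1 u.2)); last by case.
rewrite -(pair_bigA _ (fun b i => g (@zi N (b, i)) *+ (L - `|@zi N (b, i)|))) /=.
rewrite big_bool /=.
elim: L LN => [|L IH] LN.
  by rewrite big_ord0 !big1 ?addr0 // => i _; rewrite sub0n mulr0n.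
rewrite big_ord_recr /=.
under eq_bigr do rewrite big_ord_recr /=.
rewrite big_split /= IH ?(ltnW LN) //.
have E1 : \sum_(i < L) g (i%:Z - L%:Z) = \sum_(i < N | (i < L)%N) g (Negz i).
  rewrite (reindex_inj rev_ord_inj) /=.
  rewrite -(big_ord_widen N (fun i => g (Negz i))) ?(ltnW LN) //.
  by apply: eq_bigr => i _; congr g; have := ltn_ord i; lia.
have E2 : \sum_(b < L.+1) g (L%:Z - b%:Z) = \sum_(i < N | (i < L.+1)%N) g (Posz i).
  rewrite (reindex_inj rev_ord_inj) /=.
  rewrite -(big_ord_widen N (fun i => g (Posz i))) //.
  by apply: eq_bigr => i _; congr g; have := ltn_ord i; lia.
have -> : \sum_(i < N) g (Negz i) *+ (L.+1 - `|Negz i|)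
  = \sum_(i < N) g (Negz i) *+ (L - `|Negz i|) + \sum_(i < N | (i < L)%N) g (Negz i).
  rewrite [X in _ = _ + X]big_mkcond -big_split /=; apply: eq_bigr => i _.
  case: ifP => hi; last by rewrite addr0; congr (_ *+ _); lia.
  by rewrite -mulrSr; congr (_ *+ _); lia.
have -> : \sum_(i < N) g (Posz i) *+ (L.+1 - `|Posz i|)
  = \sum_(i < N) g (Posz i) *+ (L - `|Posz i|) + \sum_(i < N | (i < L.+1)%N) g (Posz i).
  rewrite [X in _ = _ + X]big_mkcond -big_split /=; apply: eq_bigr => i _.
  case: ifP => hi; last by rewrite addr0; congr (_ *+ _); lia.
  by rewrite -mulrSr; congr (_ *+ _); lia.
by rewrite E1 E2; rewrite addrACA addrA.
Qed.

Lemma fejer_tri L N x : (L <= N)%N ->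
  (fejer L x)%:C = \sum_(u : bool * 'I_N) (tri L (zi u))%:C * ee ((zi u)%:~R * x).
Proof.
move=> LN; rewrite fejer_ee.
have -> : \sum_(a < L) \sum_(b < L) ee ((a%:R - b%:R) * x)
   = \sum_(a < L) \sum_(b < L) (fun z : int => ee (z%:~R * x)) (a%:Z - b%:Z).
  by apply: eq_bigr => a _; apply: eq_bigr => b _; rewrite rmorphB.
rewrite (sum_diff (fun z : int => ee (z%:~R * x)) LN) mulr_sumr.
apply: eq_bigr => u _.
by rewrite -[X in _ * X]mulr_natl mulrA /tri rmorphM /= rmorph_nat [in RHS](mulrC _%:R).
Qed.
End Fejer.

(** * Size of the Fejer kernel and the dyadic decomposition of the inverse distance *)

Section FejerBounds.
Variable R : realType.
Local Open Scope complex_scope.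
Implicit Types x y : R.

Lemma fejerDz L (m : int) y : fejer L (m%:~R + y) = fejer L y.
Proof.
apply: complexI; rewrite !fejer_ee; congr (_ * _).
apply: eq_bigr => a _; apply: eq_bigr => b _.
rewrite mulrDr eeD -[RHS]mul1r; congr (_ * _).
by rewrite !pmulrn -rmorphB -rmorphM ee_int.
Qed.

Lemma fejerN L x : fejer L (- x) = fejer L x.
Proof.
rewrite /fejer; congr ((_ ^+ 2 + _) / _).
  by apply: eq_bigr => a _; rewrite !mulrN cosN.
rewrite -[LHS]sqrrN -sumrN; congr (_ ^+ 2).
by apply: eq_bigr => a _; rewrite !mulrN sinN opprK.
Qed.

Lemma distZ_itv x : 0 <= distZ x <= 2^-1.
Proof.
rewrite /distZ; have := floor_le x; have := floorD1_gt x.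
rewrite intrD; set f := (Num.floor x)%:~R : R => h1 h2.
rewrite le_min ge_min; apply/andP; split; first by apply/andP; split; lra.
by case: (lerP (x - f) 2^-1) => //= h; lra.
Qed.

Lemma distZ_ge0 x : 0 <= distZ x.
Proof. by have /andP[] := distZ_itv x. Qed.

Lemma distZE x : exists m : int, x = m%:~R + distZ x \/ x = m%:~R - distZ x.
Proof.
rewrite /distZ minEle; case: ifP => _.
  by exists (Num.floor x); left; ring.
by exists (Num.floor x + 1); right; ring.
Qed.

Lemma fejer_distZ L x : fejer L x = fejer L (distZ x).
Proof.
have [m [] {1}->] := distZE x; first by rewrite fejerDz.
by rewrite fejerDz fejerN.
Qed.

Lemma fejer1 x : fejer 1 x = 1.
Proof. by rewrite /fejer !big_ord1 mul0r mulr0 cos0 sin0 expr1n expr0n addr0 divr1. Qed.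

Lemma fejer0 L : (0 < L)%N -> fejer L (0 : R) = L%:R.
Proof.
move=> L0; rewrite /fejer.
under eq_bigr do rewrite !mulr0 cos0.
under [X in _ + X ^+ 2]eq_bigr do rewrite !mulr0 sin0.
by rewrite big1_eq expr0n addr0 sumr_const card_ord expr2 mulfK // pnatr_eq0 -lt0n.
Qed.

Lemma fejer_cos L x : fejer L x
  = L%:R^-1 * \sum_(a < L) \sum_(b < L) cos (2 * pi * ((a%:R - b%:R) * x)).
Proof.
have := fejer_ee L x; rewrite /ee.
under eq_bigr do rewrite sum_complex.
by rewrite sum_complex => -[-> _]; rewrite mul0r subr0.
Qed.

Lemma fejer_le L x : fejer L x <= L%:R.
Proof.
case: L => [|L]; first by rewrite /fejer invr0 mulr0.
rewrite fejer_cos mulrC ler_pdivrMr ?ltr0n //.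
have -> : L.+1%:R * L.+1%:R = \sum_(a < L.+1) \sum_(b < L.+1) 1 :> R.
  by rewrite !sumr_const !card_ord mulr_natr.
by apply: ler_sum => a _; apply: ler_sum => b _; exact: cos_le1.
Qed.

Lemma cos_piquarter_sq : cos (pi / 4) ^+ 2 = 2^-1 :> R.
Proof.
have : cos ((pi / 4) *+ 2) = 0 :> R.
  by rewrite -mulr_natr (_ : pi / 4 * 2 = pi / 2) ?cos_pihalf //; field.
rewrite cos_mulr2n -mulr_natr => h; lra.
Qed.

Lemma cos_piquarter_ge y : 0 <= y <= pi / 4 -> cos (pi / 4) <= cos y.
Proof.
move=> /andP[y0 y1]; have p0 := pi_gt0 R.
have iy : y \in `[0, pi] by rewrite in_itv /=; apply/andP; split; lra.
have iq : pi / 4 \in `[0, pi : R] by rewrite in_itv /=; apply/andP; split; lra.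
by rewrite leNgt ltr_cos // -leNgt.
Qed.

Lemma cos_piquarter_gt0 : 0 < cos (pi / 4) :> R.
Proof.
apply: cos_gt0_pihalf; have := pi_gt0 R => h; apply/andP; split; lra.
Qed.

(** All the angles [2 * pi * a * x] lie in [[0, pi / 4]], so every cosine is at least
    [cos (pi / 4)], and the square of their sum alone is at least [L ^ 2 / 2]. *)
Lemma fejer_ge L x : 0 <= x -> (8 * L%:R) * x <= 1 -> L%:R / 2 <= fejer L x.
Proof.
case: L => [|L] x0 hx; first by rewrite mul0r fejer_ge0.
rewrite /fejer ler_pdivlMr ?ltr0n //.
apply: (@le_trans _ _ ((\sum_(a < L.+1) cos (pi / 4)) ^+ 2)).
  by rewrite sumr_const card_ord -[X in X ^+ 2]mulr_natl exprMn cos_piquarter_sq; lra.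
rewrite -[leLHS]addr0 lerD ?sqr_ge0 // ler_sqr ?nnegrE ?sumr_ge0 //.
- apply: ler_sum => a _; apply: cos_piquarter_ge.
  have a1 : a%:R <= L.+1%:R :> R by rewrite ler_nat ltnW.
  have := pi_gt0 R => p0.
  apply/andP; split; first by rewrite mulr_ge0 ?mulr_ge0 ?(ltW p0).
  have : a%:R * x <= 8^-1 :> R.
    by apply: (@le_trans _ _ (L.+1%:R * x)); [rewrite ler_wpM2r | lra].
  move=> h; have : pi * (a%:R * x) <= pi * 8^-1 by rewrite ler_wpM2l // ltW.
  lra.
- by move=> a _; exact/ltW/cos_piquarter_gt0.
- move=> a _; apply: (le_trans (ltW cos_piquarter_gt0)); apply: cos_piquarter_ge.
  have a1 : a%:R <= L.+1%:R :> R by rewrite ler_nat ltnW.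
  have := pi_gt0 R => p0.
  apply/andP; split; first by rewrite mulr_ge0 ?mulr_ge0 ?(ltW p0).
  have : a%:R * x <= 8^-1 :> R.
    by apply: (@le_trans _ _ (L.+1%:R * x)); [rewrite ler_wpM2r | lra].
  move=> h; have : pi * (a%:R * x) <= pi * 8^-1 by rewrite ler_wpM2l // ltW.
  lra.
Qed.

Lemma sin_ge_quarter y : 0 <= y <= pi / 2 -> y / 4 <= sin y.
Proof.
move=> /andP[y0 y1]; have p0 := pi_gt0 R.
have c2 : 2^-1 <= cos (pi / 4) :> R.
  rewrite leNgt; apply/negP => h.
  have := cos_piquarter_sq; have := cos_piquarter_gt0; nra.
case: (ltrP 0 y) => [yp|]; last first.
  move=> h; have -> : y = 0 by apply/eqP; rewrite eq_le y0 h.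
  by rewrite sin0 mul0r.
case: (lerP y (pi / 4)) => hy.
  have sc : {within `[0, y]%classic, continuous (@sin R)}%classic.
    by apply: continuous_subspaceT => z; exact: continuous_sin.
  have [c] := @MVT R sin cos 0 y yp (fun x _ => is_derive_sin x) sc.
  rewrite in_itv /= => /andP[c0 c1]; rewrite sin0 !subr0 => ->.
  have : cos (pi / 4) <= cos c by apply: cos_piquarter_ge; apply/andP; split; lra.
  nra.
have -> : y = y - pi / 2 + pi / 2 by ring.
rewrite sinDpihalf -cosN opprB.
have : cos (pi / 4) <= cos (pi / 2 - y) by apply: cos_piquarter_ge; apply/andP; split; lra.
have := pihalf_lt2 R; lra.
Qed.

(** Multiplication by [2 * sin (pi * x)] makes the sums of cosines and of sines telescope ([hC],
    [hS]); the left side is in fact [sin (pi * L * x) ^ 2]. *)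
Lemma fejer_sin L x : (0 < L)%N -> fejer L x * sin (pi * x) ^+ 2 * L%:R <= 1.
Proof.
move=> L0; rewrite /fejer.
set C := \sum_(_ < _) cos _; set S := \sum_(_ < _) sin _.
have hC : 2 * sin (pi * x) * C = sin (2 * pi * (L%:R * x) - pi * x) + sin (pi * x).
  rewrite /C; elim: (L) => [|k IH].
    by rewrite big_ord0 mulr0 mul0r mulr0 sub0r sinN addNr.
  rewrite big_ord_recr /= mulrDr IH.
  have -> : 2 * pi * (k.+1%:R * x) - pi * x = 2 * pi * (k%:R * x) + pi * x :> R.
    by rewrite -natr1; ring.
  rewrite sinB sinD; ring.
have hS : 2 * sin (pi * x) * S = cos (pi * x) - cos (2 * pi * (L%:R * x) - pi * x).
  rewrite /S; elim: (L) => [|k IH].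
    by rewrite big_ord0 mulr0 mul0r mulr0 sub0r cosN subrr.
  rewrite big_ord_recr /= mulrDr IH.
  have -> : 2 * pi * (k.+1%:R * x) - pi * x = 2 * pi * (k%:R * x) + pi * x :> R.
    by rewrite -natr1; ring.
  rewrite cosB cosD; ring.
have L1 : L%:R != 0 :> R by rewrite pnatr_eq0 -lt0n.
have -> : (C ^+ 2 + S ^+ 2) / L%:R * sin (pi * x) ^+ 2 * L%:R
  = ((2 * sin (pi * x) * C) ^+ 2 + (2 * sin (pi * x) * S) ^+ 2) / 4 by field.
rewrite hC hS ler_pdivrMr // mul1r.
set u := _ - pi * x; set v := pi * x; clearbody u v.
have h1 := cos2Dsin2 u; have h2 := cos2Dsin2 v.
have -> : (sin u + sin v) ^+ 2 + (cos v - cos u) ^+ 2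
  = 2 - 2 * cos (u + v).
  rewrite cosD; move: (cos u) (sin u) (cos v) (sin v) h1 h2 => a b c d h1 h2.
  transitivity ((a ^+ 2 + b ^+ 2) + (c ^+ 2 + d ^+ 2) - 2 * (a * c - b * d)); first by ring.
  by rewrite h1 h2; ring.
have := cos_geN1 (u + v); lra.
Qed.

Lemma fejer_decay L x : (0 < L)%N -> 0 <= x <= 2^-1 -> fejer L x * (L%:R * x ^+ 2) <= 4.
Proof.
move=> L0 /andP[x0 x1]; have := fejer_sin x L0.
have p2 := pi_ge2 R.
have : (pi * x) / 4 <= sin (pi * x).
  by apply: sin_ge_quarter; apply/andP; split; nra.
have h : x / 2 <= pi * x / 4 by nra.
move=> /(le_trans h) h2 h3.
have h4 : (x / 2) ^+ 2 <= sin (pi * x) ^+ 2.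
  by rewrite ler_sqr ?nnegrE // ?(le_trans _ h2) ?divr_ge0.
have : fejer L x * L%:R * (x / 2) ^+ 2 <= 1.
  apply: le_trans h3; rewrite [leRHS]mulrAC ler_wpM2l // mulr_ge0 ?fejer_ge0 ?ler0n //.
lra.
Qed.

(** The bounds [L] and [4 / (L * y ^ 2)] together give a multiple of [L / ((1 + L y) (1 + 2 L y))],
    which is [g (2 L) - g L] for [g t = t / (1 + t y)]. Dyadic sums therefore telescope, and [g] is
    bounded by [1 / y]. The constant is [24 = 4 * 6], where [6] bounds the denominator in either
    case. *)
Lemma fejer_telescope L y : (0 < L)%N -> 0 < y <= 2^-1 ->
  fejer L y <= 24 * ((2 * L)%:R / (1 + (2 * L)%:R * y) - L%:R / (1 + L%:R * y)).
Proof.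
move=> L0 /andP[y0 y1].
have h1 := fejer_le L y; have h2 := @fejer_decay L y L0.
have {h2} h2 : fejer L y * (L%:R * y ^+ 2) <= 4 by apply: h2; rewrite (ltW y0).
have f0 := fejer_ge0 L y.
have Lp : 0 < L%:R :> R by rewrite ltr0n.
rewrite natrM; set F := fejer L y in f0 h1 h2 *; set M := L%:R : R in Lp h1 h2 *.
have My : 0 < M * y by rewrite mulr_gt0.
have -> : 2 * M / (1 + 2 * M * y) - M / (1 + M * y)
  = M / ((1 + M * y) * (1 + 2 * (M * y))) by field; apply/andP; split; lra.
rewrite [24 * _]mulrA ler_pdivlMr; last by rewrite mulr_gt0 //; lra.
case: (lerP (M * y) 1) => h.
  apply: (@le_trans _ _ (M * ((1 + M * y) * (1 + 2 * (M * y))))).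
    by rewrite ler_wpM2r // mulr_ge0; lra.
  rewrite mulrC ler_wpM2r //; nra.
have : F * (M * y ^+ 2) * M <= 4 * M by rewrite ler_wpM2r // ltW.
have -> : F * (M * y ^+ 2) * M = F * (M * y) ^+ 2 by ring.
move=> h3; apply: (@le_trans _ _ (F * (6 * (M * y) ^+ 2))); last by lra.
rewrite ler_wpM2l //; nra.
Qed.

Lemma sum_fejer_le J x : 0 < distZ x ->
  \sum_(j < J) fejer (2 ^ j) x <= 24 / distZ x.
Proof.
move=> d0; set y := distZ x in d0 *.
have hy : 0 < y <= 2^-1 by rewrite d0; have /andP[] := distZ_itv x.
apply: (@le_trans _ _ (24 * ((2 ^ J)%:R / (1 + (2 ^ J)%:R * y)))); last first.
  rewrite ler_pM2l // ler_pdivrMr ?addr_gt0 ?mulr_gt0 ?ltr0n ?expn_gt0 //.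
  rewrite mulrC ler_pdivlMr //; lra.
elim: J => [|J IH].
  rewrite big_ord0 expn0 mulr_ge0 // divr_ge0 //; lra.
rewrite big_ord_recr /= fejer_distZ.
have h := @fejer_telescope (2 ^ J) y; rewrite -expnS expn_gt0 in h.
have := h isT hy; lra.
Qed.

Lemma fejer_pow_ge j x : 2 ^+ (j + 3) * distZ x <= 1 -> 2 ^+ j / 2 <= fejer (2 ^ j) x.
Proof.
move=> h; rewrite fejer_distZ -natrX; apply: fejer_ge; first exact: distZ_ge0.
by move: h; rewrite exprD natrX; lra.
Qed.

(* The last clause covers [distZ x = 0], where the inverse is the junk value [0]. *)
Lemma inv_distZ_le x m : exists j : nat,
  [/\ forall i, (i <= j)%N -> 2 ^+ i / 2 <= fejer (2 ^ i) x,
      (distZ x)^-1 <= 32 * fejer (2 ^ j) x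
    & distZ x = 0 -> (m < j)%N].
Proof.
have [d0|dn0] := eqVneq (distZ x) 0.
  exists m.+1; split => // [i _|]; last by rewrite d0 invr0 mulr_ge0 ?fejer_ge0.
  by apply: fejer_pow_ge; rewrite d0 mulr0.
have d0 : 0 < distZ x by rewrite lt_def dn0 distZ_ge0.
(* [j] is the largest exponent with [2 ^ (j + 3) * distZ x <= 1], or [0] if there is none.
   Maximality gives [1 / distZ x < 2 ^ (j + 4) = 32 * (2 ^ j / 2)], whence the constant. *)
pose P i := (2 ^+ (i + 3) * distZ x <= 1) || (i == 0)%N.
have exP : exists i, P i by exists 0%N; rewrite /P eqxx orbT.
have ubP i : P i -> (i <= Num.truncn (distZ x)^-1)%N.
  case/orP => [h|/eqP -> //].
  rewrite truncn_ge_nat ?invr_ge0 ?(ltW d0) // -[leRHS]mul1r ler_pdivlMr //.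
  apply: le_trans h; rewrite ler_wpM2r ?(ltW d0) // -natrX ler_nat.
  by rewrite expnD; have := ltn_expl i (isT : 1 < 2)%N; lia.
case: (ex_maxnP exP ubP) => j Pj maxj; exists j.
have H i : P i -> 2 ^+ i / 2 <= fejer (2 ^ i) x.
  case/orP => [h|/eqP ->]; first exact: fejer_pow_ge.
  by rewrite expn0 fejer1 expr0 mul1r; lra.
split; last by move=> h; rewrite h eqxx in dn0.
- move=> i ij; apply: H; case/orP: Pj => [h|/eqP j0].
    apply/orP; left; apply: le_trans h; rewrite ler_wpM2r ?(ltW d0) //.
    by rewrite ler_weXn2l ?ler1n // leq_add2r.
  by move: ij; rewrite j0 leqn0 => /eqP ->; rewrite /P eqxx orbT.
- have hj := H _ Pj.
  have : ~~ P j.+1 by apply/negP => /maxj; rewrite ltnn.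
  rewrite /P orbF -ltNge => h.
  rewrite -[leLHS]mul1r ler_pdivrMr //.
  move: h; rewrite addSn exprS exprD => h.
  have := ler_wpM2r (ltW d0) hj; lra.
Qed.
End FejerBounds.

(** * Duality *)

Section Duality.
Variable R : realType.
Local Open Scope complex_scope.

Section Weights.
Variables (I : finType) (N : nat).
Implicit Types (L : I -> nat) (u : {ffun I -> bool * 'I_N}).

Definition wt L u : R := \prod_i tri R (L i) (zi (u i)).

Lemma wt_ge0 L u : 0 <= wt L u.
Proof. by apply: prodr_ge0 => i _; exact: tri_ge0. Qed.

Lemma wt_le1 L u : wt L u <= 1.
Proof.
by apply: prodr_ile1 => i _; rewrite tri_ge0 tri_le1.
Qed.

Lemma wt_gt0 L u : 0 < wt L u -> forall i, (`|zi (u i)| < L i)%N.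
Proof.
move=> h i; apply: (@tri_gt0 R); rewrite lt_def tri_ge0 andbT.
by apply: contraTneq h => h; rewrite /wt (bigD1 i) //= h mul0r ltxx.
Qed.

(** Distribute the product of the expansions [fejer_tri] and take real parts. The free phase [theta]
    is what allows translated summation windows later on. *)
Lemma sum_wt_cos L (x : I -> R) theta : (forall i, L i <= N)%N ->
  \sum_u wt L u * cos (2 * pi * (theta + \sum_i (zi (u i))%:~R * x i))
  = cos (2 * pi * theta) * \prod_i fejer (L i) (x i).
Proof.
move=> LN.
have : \sum_u (wt L u)%:C * ee (theta + \sum_i (zi (u i))%:~R * x i)
    = ee theta * (\prod_i fejer (L i) (x i))%:C.
  rewrite rmorph_prod /=.
  under [in RHS]eq_bigr do rewrite (fejer_tri _ (LN _)).
  rewrite bigA_distr_bigA /= mulr_sumr; apply: eq_bigr => u _.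
  by rewrite eeD ee_sum mulrCA /wt rmorph_prod -big_split.
have -> : \sum_u (wt L u)%:C * ee (theta + \sum_i (zi (u i))%:~R * x i)
  = \sum_u ((wt L u * cos (2 * pi * (theta + \sum_i (zi (u i))%:~R * x i)))
     +i* (wt L u * sin (2 * pi * (theta + \sum_i (zi (u i))%:~R * x i)))).
  apply: eq_bigr => u _; rewrite /ee; apply/eqP; rewrite eq_complex /=.
  by rewrite !mul0r subr0 addr0 !eqxx.
by rewrite sum_complex /ee => -[-> _]; rewrite mulr0 subr0.
Qed.

Lemma sum_wt L : (forall i, 0 < L i <= N)%N -> \sum_u wt L u = \prod_i (L i)%:R.
Proof.
move=> LN.
have := @sum_wt_cos L (fun=> 0) 0 (fun i => proj2 (andP (LN i))).
rewrite (eq_bigr (wt L)) => [|u _]; last first.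
  by rewrite big1 => [|i _]; rewrite ?addr0 ?mulr0 ?cos0 ?mulr1.
move=> ->; rewrite mulr0 cos0 mul1r; apply: eq_bigr => i _.
by rewrite fejer0 //; have /andP[] := LN i.
Qed.

Lemma sum_wt0 L : (0 < N)%N -> (forall i, 0 < L i)%N ->
  \sum_(u : {ffun I -> bool * 'I_N} | [forall i, zi (u i) == 0]) wt L u = 1.
Proof.
move=> N0 L0; pose u0 : {ffun I -> bool * 'I_N} := [ffun=> (false, Ordinal N0)].
rewrite (big_pred1 u0) => [|u]; last first.
  apply/forallP/eqP => [h|-> i]; last by rewrite ffunE.
  by apply/ffunP => i; rewrite ffunE; apply: zi_inj; rewrite (eqP (h i)).
by rewrite /wt big1 // => i _; rewrite ffunE /= tri0.
Qed.
End Weights.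

Section Bilinear.
Variables (I K : finType) (A : I -> K -> R).

Definition psi (q : I -> int) (k : K) : R := \sum_i (q i)%:~R * A i k.
Definition phi (m : K -> int) (i : I) : R := \sum_k (m k)%:~R * A i k.

Lemma psi_phi q m : \sum_k (m k)%:~R * psi q k = \sum_i (q i)%:~R * phi m i.
Proof.
rewrite /psi /phi; under eq_bigr do rewrite mulr_sumr.
rewrite exchange_big; apply: eq_bigr => i _; rewrite mulr_sumr.
by apply: eq_bigr => k _; rewrite mulrCA.
Qed.

(* What the duality formula leaves after removing the frequency [0]. *)
Definition err (N : nat) (L : I -> nat) (M : K -> nat) : R :=
  \sum_(v : {ffun K -> bool * 'I_N} | ~~ [forall k, zi (v k) == 0])
     wt M v * \prod_i fejer (L i) (phi (fun k => zi (v k)) i).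

Lemma err_ge0 N L M : 0 <= err N L M.
Proof.
apply: sumr_ge0 => v _; rewrite mulr_ge0 ?wt_ge0 //.
by apply: prodr_ge0 => i _; exact: fejer_ge0.
Qed.

(** Expanding the kernels on both sides by [sum_wt_cos] gives the same double sum of cosines, since
    [psi_phi] exchanges the two systems of forms. The translation [s] of the window survives only as
    a phase on the dual side. *)
Lemma sum_fejer_dual N (L : I -> nat) (M : K -> nat) (s : I -> int) :
  (forall i, L i <= N)%N -> (forall k, M k <= N)%N ->
  \sum_(u : {ffun I -> bool * 'I_N})
     wt L u * \prod_k fejer (M k) (psi (fun i => s i + zi (u i)) k)
  = \sum_(v : {ffun K -> bool * 'I_N})
     wt M v * (cos (2 * pi * \sum_i (s i)%:~R * phi (fun k => zi (v k)) i)
               * \prod_i fejer (L i) (phi (fun k => zi (v k)) i)).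
Proof.
move=> LN MN.
under [RHS]eq_bigr do rewrite -(sum_wt_cos _ _ LN) mulr_sumr.
rewrite exchange_big; apply: eq_bigr => u _ /=.
transitivity (wt L u * (cos (2 * pi * 0)
    * \prod_k fejer (M k) (psi (fun i => s i + zi (u i)) k))).
  by rewrite mulr0 cos0 mul1r.
rewrite -(sum_wt_cos _ _ MN) mulr_sumr; apply: eq_bigr => v _.
rewrite mulrCA add0r psi_phi; congr (_ * (_ * cos (_ * _))).
by rewrite -big_split; apply: eq_bigr => i _ /=; rewrite rmorphD mulrDl.
Qed.

(** The zero frequency has weight [1], and each kernel at [0] equals [L i]: this is the main term.
    Elsewhere the phase is at most [1] in absolute value, so the error bound does not depend on
    [s]. *)
Lemma sum_fejer_approx N (L : I -> nat) (M : K -> nat) (s : I -> int) :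
  (0 < N)%N -> (forall i, 0 < L i <= N)%N -> (forall k, 0 < M k <= N)%N ->
  `|\sum_(u : {ffun I -> bool * 'I_N})
     wt L u * \prod_k fejer (M k) (psi (fun i => s i + zi (u i)) k)
   - \prod_i (L i)%:R| <= err N L M.
Proof.
move=> N0 LN MN; rewrite sum_fejer_dual; last 2 first.
- by move=> i; have /andP[] := LN i.
- by move=> i; have /andP[] := MN i.
rewrite (bigID (fun v : {ffun K -> bool * 'I_N} => [forall k, zi (v k) == 0])) /=.
have -> : \sum_(v : {ffun K -> bool * 'I_N} | [forall k, zi (v k) == 0])
     wt M v * (cos (2 * pi * \sum_i (s i)%:~R * phi (fun k => zi (v k)) i)
               * \prod_i fejer (L i) (phi (fun k => zi (v k)) i))
     = \prod_i (L i)%:R.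
  transitivity (\sum_(v : {ffun K -> bool * 'I_N} | [forall k, zi (v k) == 0])
      wt M v * \prod_i (L i)%:R).
    apply: eq_bigr => v /forallP hv; congr (_ * _).
    have p0 i : phi (fun k => zi (v k)) i = 0.
      by rewrite /phi big1 // => k _; rewrite (eqP (hv k)) mul0r.
    rewrite big1 => [|i _]; last by rewrite p0 mulr0.
    rewrite mulr0 cos0 mul1r; apply: eq_bigr => i _; rewrite p0 fejer0 //.
    by have /andP[] := LN i.
  by rewrite -mulr_suml sum_wt0 ?mul1r // => k; have /andP[] := MN k.
rewrite addrAC subrr add0r; apply: (le_trans (ler_norm_sum _ _ _)).
apply: ler_sum => v _; rewrite normrM ger0_norm ?wt_ge0 // ler_wpM2l ?wt_ge0 //.
have P0 : 0 <= \prod_i fejer (L i) (phi (fun k => zi (v k)) i).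
  by apply: prodr_ge0 => i _; exact: fejer_ge0.
by rewrite normrM [X in _ * X]ger0_norm // ler_piMl // cos_max.
Qed.
End Bilinear.
End Duality.

(** * Null sets and Borel-Cantelli *)

Section NullSets.
Variable R : realType.

Lemma ler_sum_inj (T U : finType) (P : pred T) (Q : pred U) (F : T -> R)
    (G : U -> R) (h : T -> U) :
  {in P &, injective h} -> (forall t, P t -> Q (h t)) ->
  (forall t, P t -> F t <= G (h t)) -> (forall u, Q u -> 0 <= G u) ->
  \sum_(t | P t) F t <= \sum_(u | Q u) G u.
Proof.
move=> hinj hPQ hF hG.
apply: (@le_trans _ _ (\sum_(t | P t) G (h t))); first exact: ler_sum.
rewrite (eq_bigl (fun t => t \in [set t | P t]%SET)) => [|t]; last by rewrite inE.
rewrite -(@big_imset _ _ _ _ _ h) /=; last first.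
  by move=> x y; rewrite !inE => Px Py; apply: hinj.
rewrite [leRHS](bigID (fun u => u \in h @: [set t | P t]%SET)) /=.
rewrite -[leLHS]addr0 lerD //; last first.
  by apply: sumr_ge0 => u /andP[Qu _]; exact: hG.
rewrite le_eqVlt; apply/orP; left; apply/eqP; apply: eq_bigl => u.
case: imsetP => [[t]|]; last by rewrite andbF.
by rewrite inE => Pt ->; rewrite hPQ.
Qed.

Lemma bernoulli (x : R) (s : nat) : 0 <= x -> 1 + s%:R * x <= (1 + x) ^+ s.
Proof.
move=> x0; elim: s => [|s IH]; first by rewrite mul0r addr0 expr0.
rewrite exprS; apply: (@le_trans _ _ ((1 + x) * (1 + s%:R * x))).
  rewrite -natr1; have : 0 <= s%:R * x ^+ 2 by rewrite mulr_ge0 ?sqr_ge0.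
  nra.
by rewrite ler_wpM2l //; lra.
Qed.

Lemma sum_geom34 S : \sum_(s < S) (3 / 4 : R) ^+ s <= 4 * (1 - (3 / 4) ^+ S).
Proof.
elim: S => [|S IH]; first by rewrite big_ord0 expr0 subrr mulr0.
by rewrite big_ord_recr /= exprS; lra.
Qed.

Lemma geom34_small (c eps : R) : 0 < eps -> 0 <= c -> exists s, c * (3 / 4) ^+ s < eps.
Proof.
move=> e0 c0; exists (Num.truncn (3 * c / eps)).+1; set s := (Num.truncn _).+1.
have hs : 3 * c / eps < s%:R by exact: truncnS_gt.
have := @bernoulli (1 / 3) s (ltac:(lra)).
have -> : 1 + 1 / 3 = 4 / 3 :> R by lra.
move=> hb.
have p0 : 0 < (4 / 3 : R) ^+ s by rewrite exprn_gt0 //; lra.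
have -> : (3 / 4 : R) = (4 / 3)^-1 by field.
rewrite exprVn -[X in X < _]/(c / (4 / 3) ^+ s) ltr_pdivrMr //.
move: hs; rewrite ltr_pdivrMr // => hs.
have : eps * (1 + s%:R * (1 / 3)) <= eps * (4 / 3) ^+ s by rewrite ler_wpM2l // ltW.
lra.
Qed.

(* Comparing [(s + 1) ^ m] with a product of [m] Bernoulli bounds of ratio
   [1 + 1 / (3 m)], whose [m]-th power is at most [3 / 2]. *)
Lemma poly_le_geom (m : nat) : exists2 C : R, 0 <= C &
  forall s : nat, s.+1%:R ^+ m <= C * (3 / 2) ^+ s.
Proof.
case: m => [|m].
  exists 1 => // s; rewrite expr0 mul1r exprn_ege1 //; lra.
pose x : R := (3 * m.+1%:R)^-1.
have m0 : 0 < m.+1%:R :> R by rewrite ltr0n.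
have m1 : 1 <= m.+1%:R :> R by rewrite ler1n.
have x0 : 0 < x by rewrite invr_gt0 mulr_gt0.
have x1 : x <= 1 by rewrite invf_le1 ?mulr_gt0 //; lra.
have hx : (1 + x) ^+ m.+1 <= 3 / 2.
  have key : forall k, (k%:R * x <= 1) -> (1 + x) ^+ k * (1 - k%:R * x) <= 1.
    elim=> [|k IH]; first by rewrite expr0 mul0r subr0 mul1r.
    rewrite -natr1 => hk.
    have k0 : 0 <= k%:R * x by rewrite mulr_ge0 // ltW.
    apply: le_trans (IH _); last by lra.
    rewrite exprS -mulrA mulrCA ler_wpM2l ?exprn_ge0 //; first by lra.
    nra.
  have mx : m.+1%:R * x = 1 / 3 by rewrite /x; field; rewrite nat1r; lra.
  by have := key m.+1; rewrite mx; lra.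
exists (x ^- m.+1); first by rewrite invr_ge0 exprn_ge0 // ltW.
move=> s; rewrite mulrC ler_pdivlMr ?exprn_gt0 // -exprMn.
apply: (@le_trans _ _ (((1 + x) ^+ m.+1) ^+ s)).
  rewrite -exprM mulnC exprM; apply: lerXn2r; rewrite ?nnegrE.
  - by rewrite mulr_ge0 // ltW.
  - by rewrite exprn_ge0 //; lra.
  - by apply: le_trans (bernoulli _ (ltW x0)); rewrite -natr1; lra.
apply: lerXn2r => //; rewrite nnegrE ?exprn_ge0 //; lra.
Qed.

Section Boxes.
Variable n : nat.
Let box := (('I_n -> R) * ('I_n -> R))%type.
Definition vol (b : box) : R := \prod_(i < n) (b.2 i - b.1 i).
Definition in_box (b : box) (x : 'I_n -> R) := forall i, b.1 i <= x i <= b.2 i.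
Definition ordered (b : box) := forall i, b.1 i <= b.2 i.

Lemma vol_ge0 b : ordered b -> 0 <= vol b.
Proof. by move=> h; apply: prodr_ge0 => i _; rewrite subr_ge0. Qed.

Lemma sum_nth_le (r : seq box) (d : box) S : (forall b, List.In b r -> ordered b) ->
  \sum_(i < S | (i < size r)%N) vol (nth d r i) <= \sum_(b <- r) vol b.
Proof.
move=> hr; rewrite (big_nth d) big_mkord.
have inr i : (i < size r)%N -> List.In (nth d r i) r.
  by elim: (r) i => [//|b r' IH] [|i] /=; [left | move=> /IH; right].
case: r hr inr => [|b r] hr inr; first by rewrite big_pred0 // big_ord0.
apply: (@ler_sum_inj 'I_S 'I_(size r).+1 (fun i => i < size (b :: r))%N xpredT
  (fun i => vol (nth d (b :: r) i)) (fun i => vol (nth d (b :: r) i))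
  (fun i => inord i)) => //.
- move=> i j; rewrite !unfold_in => hi hj /(congr1 val) /=; rewrite !inordK // => e.
  exact: val_inj.
- by move=> i hi; rewrite inordK.
- by move=> i _; apply: vol_ge0; apply: hr; apply: inr.
Qed.

(** [lebesgue_null] asks for one sequence of boxes, whereas the covers arise as one finite list per
    level. Pairs of a level and a position are coded by natural numbers; the other codes get a
    degenerate box, of volume [0] because [n > 0]. *)
Lemma lebesgue_null_seq (E : set ('I_n -> R)) : (0 < n)%N ->
  (forall eps : R, 0 < eps -> exists r : nat -> seq box,
    [/\ forall s b, List.In b (r s) -> ordered b,
        forall x, E x -> exists s, exists2 b, List.In b (r s) & in_box b x
      & forall S, \sum_(s < S) \sum_(b <- r s) vol b < eps]) ->
  lebesgue_null E.
Proof.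
move=> n0 H eps /H [r [rord rcov rsum]].
pose d : box := (fun=> 0, fun=> 0).
have vd : vol d = 0 by rewrite /vol (bigD1 (Ordinal n0)) //= subrr mul0r.
pose bx (k : nat) : box :=
  if @pickle_inv (nat * nat)%type k is Some p then nth d (r p.1) p.2 else d.
have nthr s i : (i < size (r s))%N -> List.In (nth d (r s) i) (r s).
  by elim: (r s) i => [//|b r' IH] [|i] /=; [left | move=> /IH; right].
exists (fun k => (bx k).1), (fun k => (bx k).2); split; [|split].
- move=> k i; rewrite /bx; case: pickle_inv => [[s j]|] //=.
  case: (ltnP j (size (r s))) => hj; last by rewrite nth_default.
  exact: (rord _ _ (nthr _ _ hj)).
- move=> x /rcov[s [b hb xb]].
  have [j hj bj] : exists2 j, (j < size (r s))%N & nth d (r s) j = b.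
    elim: (r s) hb => [//|c r' IH] [<-|/IH[j hj <-]]; first by exists 0%N.
    by exists j.+1.
  by exists (pickle (s, j)) => i; rewrite /bx pickleK_inv /= bj.
- move=> N.
  pose pk (k : nat) : nat * nat := odflt (0, 0)%N (@pickle_inv (nat * nat)%type k).
  pose S := (\sum_(k < N) ((pk k).1 + (pk k).2)).+1.
  have pkS (k : 'I_N) : ((pk k).1 < S)%N && ((pk k).2 < S)%N.
    by rewrite /S (bigD1 k) //=; lia.
  pose P (k : 'I_N) := if @pickle_inv (nat * nat)%type k is Some p
    then (p.2 < size (r p.1))%N else false.
  apply: le_lt_trans (rsum S).
  rewrite (bigID P) /= [X in _ + X]big1 ?addr0; last first.
    move=> k; rewrite /P -/(vol (bx k)) /bx; case: pickle_inv => [[s j]|] //=.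
    by rewrite -leqNgt => hj; rewrite nth_default.
  apply: (@le_trans _ _ (\sum_(s < S) \sum_(i < S | (i < size (r s))%N) vol (nth d (r s) i))); last first.
    by apply: ler_sum => s _; apply: sum_nth_le; exact: rord.
  rewrite (pair_big_dep xpredT (fun (s i : 'I_S) => (i < size (r s))%N)) /=.
  apply: (@ler_sum_inj _ _ _ _ _ _ (fun k : 'I_N => (inord (pk k).1, inord (pk k).2))).
  + move=> k l; rewrite !unfold_in /P /pk.
    have := pkS k; have := pkS l; rewrite /pk.
    case el : pickle_inv => [q|] //; case ek : pickle_inv => [p|] //=.
    move=> /andP[q1 q2] /andP[p1 p2] _ _ [] /(congr1 val) /=; rewrite !inordK // => e1.
    move=> /(congr1 val) /=; rewrite !inordK // => e2.
    apply: val_inj => /=.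
    have /= := @pickle_invK (nat * nat)%type k; rewrite ek /= => <-.
    have /= := @pickle_invK (nat * nat)%type l; rewrite el /= => <-.
    by case: (p) (q) e1 e2 => [? ?] [? ?] /= -> ->.
  + move=> k; rewrite /P; have := pkS k; rewrite /pk; case: pickle_inv => [p|] //=.
    by move=> /andP[p1 p2]; rewrite !inordK.
  + move=> k; rewrite /P -/(vol (bx k)) /bx; have := pkS k; rewrite /pk.
    by case: pickle_inv => [p|] //= /andP[p1 p2]; rewrite !inordK.
  + by move=> [s i] /= hi; apply: vol_ge0; apply: rord; exact: nthr.
Qed.
End Boxes.
End NullSets.

(** * Means over grids, Markov's inequality and Borel-Cantelli *)

Section Mean.
Variables (R : realType) (n : nat).
Local Open Scope complex_scope.
Implicit Types (f g : ('I_n -> R) -> R) (mu nu : R).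

Definition gridpt (s N : nat) (x : {ffun 'I_n -> 'I_(2 * s * N)}) : 'I_n -> R :=
  fun i => (x i)%:R / N%:R - s%:R.

(* [mean f mu] holds for trigonometric polynomials with integer frequencies and
   constant term [mu]: averaging over a fine enough grid is then exact. *)
Definition mean f mu :=
  (exists2 lam : R, 0 <= lam & forall a b delta,
     (forall i, `|a i - b i| <= delta) -> f a <= f b + lam * delta)
  /\ exists N0 : nat, forall N s, (N0 < N)%N ->
     \sum_x f (@gridpt s N x) = mu * ((2 * s * N) ^ n)%:R.

Lemma mean_ext f g mu : f =1 g -> mean f mu -> mean g mu.
Proof.
move=> fg [[lam l0 hl] [N0 hN]]; split.
  by exists lam => // a b d h; rewrite -!fg; exact: hl.
by exists N0 => N s NN; rewrite -hN //; apply: eq_bigr => x _; rewrite fg.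
Qed.

Lemma mean0 : mean (fun=> 0) 0.
Proof.
split; first by exists 0 => // a b d _; rewrite mul0r addr0.
by exists 0%N => N s _; rewrite big1_eq mul0r.
Qed.

Lemma meanD f g mu nu : mean f mu -> mean g nu -> mean (fun a => f a + g a) (mu + nu).
Proof.
move=> [[l l0 hl] [N0 hN]] [[l' l'0 hl'] [N0' hN']]; split.
  exists (l + l'); first exact: addr_ge0.
  by move=> a b d h; have := hl a b d h; have := hl' a b d h; lra.
exists (N0 + N0')%N => N s NN; rewrite big_split /= hN ?hN' ?mulrDl //; lia.
Qed.

Lemma meanZ c f mu : 0 <= c -> mean f mu -> mean (fun a => c * f a) (c * mu).
Proof.
move=> c0 [[l l0 hl] [N0 hN]]; split.
  exists (c * l); first exact: mulr_ge0.
  by move=> a b d /hl h; rewrite -mulrA -mulrDr ler_wpM2l.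
by exists N0 => N s NN; rewrite -mulr_sumr hN // mulrA.
Qed.

Lemma cos_lip (x y : R) : cos x <= cos y + `|x - y|.
Proof.
have cc (a b : R) : {within `[a, b]%classic, continuous (@cos R)}%classic.
  by apply: continuous_subspaceT => z; exact: continuous_cos.
have H (a b : R) : a < b -> `|cos b - cos a| <= b - a.
  move=> ab; have [c _ ->] := @MVT R cos (fun z => - sin z) a b ab (fun z _ => is_derive_cos z) (cc a b).
  rewrite normrM normrN (@ger0_norm _ (b - a)) ?subr_ge0 ?(ltW ab) //.
  by rewrite ler_piMl ?sin_max // subr_ge0 ltW.
case: (ltgtP x y) => [xy|xy|->]; last by rewrite subrr normr0 addr0.
- have := H _ _ xy; rewrite distrC (distrC x) (gtr0_norm (_ : 0 < y - x)) ?subr_gt0 //.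
  by move=> h; have := ler_norm (cos x - cos y); lra.
- have := H _ _ xy; rewrite (gtr0_norm (_ : 0 < x - y)) ?subr_gt0 //.
  by move=> h; have := ler_norm (cos x - cos y); lra.
Qed.

(** The grid fills an interval of integer length with step [1 / N], so the geometric progression of
    ratio [ee (v / N)] closes up; [0 < |v| < N] makes that ratio different from [1]. *)
Lemma sum_root0 (v : int) (s N : nat) : v != 0 -> (`|v| < N)%N ->
  \sum_(x < 2 * s * N) ee (v%:~R * (x%:R / N%:R - s%:R : R)) = 0.
Proof.
move=> v0 vN.
have N0 : N%:R != 0 :> R by rewrite pnatr_eq0; lia.
have hz : ee (v%:~R / N%:R : R) != 1.
  apply: ee_eq1; rewrite normrM normfV (@ger0_norm _ N%:R) ?ler0n //.
  rewrite divr_gt0 ?normr_gt0 ?intr_eq0 //=; last by rewrite ltr0n; lia.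
  rewrite ltr_pdivrMr ?mul1r; last by rewrite ltr0n; lia.
  by rewrite -intr_norm -[N%:R]/(N%:Z%:~R) ltr_int; lia.
transitivity (ee (- (v%:~R * s%:R) : R) * \sum_(x < 2 * s * N) ee (v%:~R / N%:R) ^+ x).
  rewrite mulr_sumr; apply: eq_bigr => x _; rewrite -ee_mulrn -eeD; congr ee.
  by rewrite mulrBr; ring.
suff : (ee (v%:~R / N%:R : R) - 1) * \sum_(x < 2 * s * N) ee (v%:~R / N%:R) ^+ x = 0.
  by move/eqP; rewrite mulf_eq0 subr_eq0 (negPf hz) /= => /eqP ->; rewrite mulr0.
rewrite -subrX1 -ee_mulrn natrM.
have -> : (2 * s)%:R * N%:R * (v%:~R / N%:R) = ((2 * s)%:Z * v)%:~R :> R.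
  by rewrite rmorphM /= -pmulrn; field.
by rewrite ee_int subrr.
Qed.

Lemma mean_cos (v : 'I_n -> int) :
  mean (fun a => cos (2 * pi * \sum_i (v i)%:~R * a i)) ([forall i, v i == 0]%:R).
Proof.
split.
  exists (2 * pi * \sum_i `|(v i)%:~R|) => [|a b d h].
    by rewrite mulr_ge0 ?mulr_ge0 ?pi_ge0 // sumr_ge0.
  have := cos_lip (2 * pi * \sum_i (v i)%:~R * a i) (2 * pi * \sum_i (v i)%:~R * b i).
  move=> /le_trans; apply; rewrite lerD2l -mulrBr normrM ger0_norm ?mulr_ge0 ?pi_ge0 //.
  rewrite -mulrA ler_wpM2l ?mulr_ge0 ?pi_ge0 //.
  rewrite -sumrB mulr_suml; apply: le_trans (ler_norm_sum _ _ _) _.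
  by apply: ler_sum => i _; rewrite -mulrBr normrM ler_wpM2l.
exists (\sum_i `|v i|)%N => N s NN.
have : \sum_(x : {ffun 'I_n -> 'I_(2 * s * N)}) ee (\sum_i (v i)%:~R * gridpt x i)
   = (([forall i, v i == 0]%:R * ((2 * s * N) ^ n)%:R : R))%:C.
  under eq_bigr do rewrite ee_sum.
  rewrite -(bigA_distr_bigA (fun i (x : 'I_(2 * s * N)) => ee ((v i)%:~R * (x%:R / N%:R - s%:R)))).
  have [/forallP v0|/forallPn[i vi]] := boolP [forall i, v i == 0].
    rewrite mul1r; under eq_bigr => i _.
      under eq_bigr do rewrite (eqP (v0 i)) mul0r ee0.
      rewrite sumr_const card_ord.
    over.
    by rewrite prodr_const card_ord -natrX rmorph_nat.
  rewrite mul0r (bigD1 i) //= sum_root0 ?mul0r //.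
  by apply: leq_ltn_trans NN; rewrite (bigD1 i) //= leq_addr.
by rewrite /ee sum_complex => -[-> _].
Qed.

(** Markov's inequality on a grid. By the Lipschitz bound, a cell containing a point with [f >= 1]
    has [f + lam / N >= 1] at its corner. The number of such corners is at most the sum of
    [f + lam / N] over the grid, which the exact mean evaluates; [N] is chosen so large that
    [lam / N] contributes at most [eta]. *)
Lemma mean_cover f mu (s : nat) (eta : R) : (forall a, 0 <= f a) -> mean f mu -> 0 < eta ->
  exists r : seq (('I_n -> R) * ('I_n -> R)),
   [/\ forall b, List.In b r -> ordered b,
       forall a, (forall i, `|a i| < s%:R) -> 1 <= f a -> exists2 b, List.In b r & in_box b a
     & \sum_(b <- r) vol b <= ((2 * s) ^ n)%:R * mu + eta].
Proof.
move=> f0 [[lam l0 hl] [N0 hN]] eta0.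
pose N := (N0 + Num.truncn (((2 * s) ^ n)%:R * lam / eta)).+1.
have Np : 0 < N%:R :> R by rewrite ltr0n.
have NN : ((2 * s) ^ n)%:R * lam <= eta * N%:R.
  rewrite [leRHS]mulrC -ler_pdivrMr //; apply: ltW; apply: lt_le_trans (truncnS_gt _) _.
  by rewrite ler_nat /N ltnS leq_addl.
have N0N : (N0 < N)%N by rewrite ltnS leq_addr.
clearbody N.
pose P (x : {ffun 'I_n -> 'I_(2 * s * N)}) := 1 <= f (gridpt x) + lam / N%:R.
pose bx (x : {ffun 'I_n -> 'I_(2 * s * N)}) := (gridpt x, fun i => gridpt x i + N%:R^-1).
have Nv : 0 <= N%:R^-1 :> R by rewrite invr_ge0 ler0n.
exists [seq bx x | x <- enum P]; split.
- move=> b; elim: (enum P) => [//|x r IH] /= [<-|/IH //] i /=.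
  by rewrite lerDl.
- move=> a ha fa.
  have hi i : 0 <= (a i + s%:R) * N%:R.
    by rewrite mulr_ge0 ?ler0n //; have := ha i; rewrite ltr_norml; lra.
  have hx i : (Num.truncn ((a i + s%:R) * N%:R) < 2 * s * N)%N.
    rewrite truncn_lt_nat // natrM ltr_pM2r // natrM.
    by have := ha i; rewrite ltr_norml; lra.
  pose x : {ffun 'I_n -> 'I_(2 * s * N)} := [ffun i => Ordinal (hx i)].
  have bxa : in_box (bx x) a.
    move=> i; rewrite /bx /gridpt /= ffunE /=.
    have /andP[h1 h2] := truncn_itv (hi i).
    rewrite lerBlDr ler_pdivrMr // h1 /=.
    rewrite -[leRHS]addrAC -{2}[N%:R^-1]mul1r -mulrDl natr1 lerBrDr ler_pdivlMr //.
    exact: ltW.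
  exists (bx x) => //.
  have Px : x \in enum P.
    rewrite mem_enum /P unfold_in; apply: le_trans fa _; apply: hl => i.
    have := bxa i; rewrite /= => /andP[h1 h2].
    by rewrite ger0_norm ?subr_ge0 // lerBlDl.
  by elim: (enum P) Px => [//|y r IH]; rewrite inE => /orP[/eqP ->|/IH]; [left|right].
- have volx x : vol (bx x) = (N ^ n)%:R^-1.
    rewrite /vol /bx /=; under eq_bigr do rewrite addrC addKr.
    by rewrite prodr_const card_ord natrX exprVn.
  rewrite big_map big_enum /= (eq_bigr (fun=> (N ^ n)%:R^-1)) => [|x _]; last exact: volx.
  apply: (@le_trans _ _ (\sum_(x : {ffun 'I_n -> 'I_(2 * s * N)})
     (f (gridpt x) + lam / N%:R) * (N ^ n)%:R^-1)).
    rewrite [leRHS](bigID P) /= -[leLHS]addr0 lerD //.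
      by apply: ler_sum => x Px; rewrite ler_peMl ?invr_ge0.
    by apply: sumr_ge0 => x _; rewrite mulr_ge0 ?invr_ge0 // addr_ge0 // mulr_ge0.
  rewrite -mulr_suml big_split /=. rewrite (hN N s N0N).
  rewrite sumr_const card_ffun !card_ord -[lam / N%:R *+ _]mulr_natr -mulrDl -mulrA.
  rewrite expnMn natrM mulfK; last by rewrite natrX expf_neq0 ?lt0r_neq0.
  rewrite mulrDl [mu * _]mulrC lerD2l.
  by rewrite mulrAC ler_pdivrMr // [leLHS]mulrC.
Qed.

(** The set [f s >= 1] is covered only inside the cube of half-side [s.+1]. These cubes grow, so a
    fixed point lies in all but finitely many of them; the factor [(2 * s.+1) ^ n] in the hypothesis
    is their volume. *)
Lemma ae_eventually_lt1 (f : nat -> ('I_n -> R) -> R) (mu : nat -> R) (C : R) :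
  (0 < n)%N -> (forall s, mean (f s) (mu s)) -> (forall s a, 0 <= f s a) -> 0 <= C ->
  (forall s, ((2 * s.+1) ^ n)%:R * mu s <= C * (3 / 4) ^+ s) ->
  ae_Rn (fun a => exists s0, forall s, (s0 <= s)%N -> f s a < 1).
Proof.
move=> n0 fmu f0 C0 hC; apply: lebesgue_null_seq => // eps eps0.
(* The cover of level [s] has volume at most [(C + 1) * (3 / 4) ^ s]: [C] from the mean, [1] from
   the choice of [eta] as [(3 / 4) ^ s]. Summing from [s1] on gives the factor [4]. *)
have [s1 hs1] := @geom34_small R (4 * (C + 1)) eps eps0 (ltac:(lra)).
have p0 s : 0 < (3 / 4 : R) ^+ s by rewrite exprn_gt0 //; lra.
have /choice[r hr] s := mean_cover s.+1 (f0 s) (fmu s) (p0 s).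
exists (fun s => r (s1 + s)%N); split.
- by move=> s b; have [h _ _] := hr (s1 + s)%N; exact: h.
- move=> a /= Ha.
  pose B := \sum_i `|a i|; have B0 : 0 <= B by apply: sumr_ge0.
  have [s /andP[sS sf]] : exists s, (s1 + (Num.truncn B) <= s)%N && (1 <= f s a).
    apply: contrapT => Hs; apply: Ha; exists (s1 + (Num.truncn B))%N => s hs.
    by rewrite ltNge; apply/negP => h; apply: Hs; exists s; rewrite hs.
  exists (s - s1)%N; rewrite subnKC ?(leq_trans (leq_addr _ _) sS) //.
  have [_ h _] := hr s; apply: h => // i.
  apply: (@le_lt_trans _ _ B); first by rewrite /B (bigD1 i) //= lerDl sumr_ge0.
  apply: lt_le_trans (truncnS_gt _) _; rewrite ler_nat ltnS.
  by apply: leq_trans sS; rewrite leq_addl.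
- move=> S; apply: le_lt_trans hs1.
  apply: (@le_trans _ _ (\sum_(s < S) (C + 1) * (3 / 4) ^+ s1 * (3 / 4) ^+ s)).
    apply: ler_sum => s _; have [_ _ h] := hr (s1 + s)%N; apply: (le_trans h).
    by have := hC (s1 + s)%N; rewrite exprD; lra.
  rewrite -mulr_sumr.
  have := @sum_geom34 R S; have := p0 S => pS hS.
  have : (C + 1) * (3 / 4) ^+ s1 * \sum_(s < S) (3 / 4 : R) ^+ s <= (C + 1) * (3 / 4) ^+ s1 * 4.
    by rewrite ler_wpM2l ?mulr_ge0 ?(ltW (p0 _)) //; lra.
  lra.
Qed.
End Mean.

Section MeanLe.
Variables (R : realType) (n : nat).
Implicit Types (f g : ('I_n -> R) -> R) (c : R).

Definition mean_le f c := exists2 mu : R, mean f mu & mu <= c.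

Lemma mean_le_ext f g c : f =1 g -> mean_le f c -> mean_le g c.
Proof. by move=> fg [mu fmu muc]; exists mu => //; exact: mean_ext fmu. Qed.

Lemma mean_le_trans f c d : c <= d -> mean_le f c -> mean_le f d.
Proof. by move=> cd [mu fmu muc]; exists mu => //; exact: le_trans cd. Qed.

Lemma mean_leZ a f c : 0 <= a -> mean_le f c -> mean_le (fun x => a * f x) (a * c).
Proof.
by move=> a0 [mu fmu muc]; exists (a * mu); [exact: meanZ | exact: ler_wpM2l].
Qed.

Lemma mean_le_sum (T : Type) (r : seq T) (P : pred T) (F : T -> ('I_n -> R) -> R)
    (c : T -> R) : (forall t, P t -> mean_le (F t) (c t)) ->
  mean_le (fun a => \sum_(t <- r | P t) F t a) (\sum_(t <- r | P t) c t).
Proof.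
move=> H; elim: r => [|t r [mu IH IHc]].
  by exists 0; [apply: mean_ext (mean0 _ _) => a|]; rewrite big_nil.
rewrite big_cons; case: ifP => Pt; last first.
  by exists mu => //; apply: mean_ext IH => a; rewrite big_cons Pt.
have [nu hnu nuc] := H t Pt; exists (nu + mu); last exact: lerD.
by apply: mean_ext (meanD hnu IH) => a; rewrite big_cons Pt.
Qed.

(** In the Fourier expansion the mean keeps only the [z] with [w z = 0]; by hypothesis this is
    [z = 0] alone, of weight [1]. *)
Lemma mean_le_prod_fejer (J : finType) (N : nat) (L : J -> nat)
    (x : J -> ('I_n -> R) -> R) (w : (J -> int) -> 'I_n -> int) :
  (0 < N)%N -> (forall j, 0 < L j <= N)%N ->
  (forall z a, \sum_j (z j)%:~R * x j a = \sum_i (w z i)%:~R * a i) ->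
  (forall z, (forall i, w z i = 0) -> forall j, z j = 0) ->
  mean_le (fun a => \prod_j fejer (L j) (x j a)) 1.
Proof.
move=> N0 LN xw w0.
have LN' j : (L j <= N)%N by have /andP[] := LN j.
have L0 j : (0 < L j)%N by have /andP[] := LN j.
pose Z (u : {ffun J -> bool * 'I_N}) : J -> int := fun j => zi (u j).
apply: (@mean_le_ext (fun a => \sum_u wt R L u * cos (2 * pi * \sum_i (w (Z u) i)%:~R * a i))).
  move=> a; transitivity (cos (2 * pi * 0) * \prod_j fejer (L j) (x j a)); last first.
    by rewrite mulr0 cos0 mul1r.
  rewrite -(sum_wt_cos (fun j => x j a) 0 LN'); apply: eq_bigr => u _.
  by rewrite add0r xw.
apply: (@mean_le_trans _ (\sum_u wt R L u * [forall i, w (Z u) i == 0]%:R)); last first.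
  apply: mean_le_sum => u _; apply: mean_leZ; first exact: wt_ge0.
  by exists [forall i, w (Z u) i == 0]%:R => //; exact: mean_cos.
rewrite -[leRHS](sum_wt0 R N0 L0) [leRHS]big_mkcond /=; apply: ler_sum => u _.
case: (boolP [forall i, w (Z u) i == 0]) => [/forallP h|_]; last first.
  by rewrite /= mulr0; case: ifP; rewrite // wt_ge0.
rewrite mulr1 ifT //; apply/forallP => j; apply/eqP.
by apply: (w0 (Z u)) => i; exact/eqP.
Qed.

Lemma ae_eventually_lt1_le (f : nat -> ('I_n -> R) -> R) (c : nat -> R) (C : R) :
  (0 < n)%N -> (forall s, mean_le (f s) (c s)) -> (forall s a, 0 <= f s a) -> 0 <= C ->
  (forall s, ((2 * s.+1) ^ n)%:R * c s <= C * (3 / 4) ^+ s) ->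
  ae_Rn (fun a => exists s0, forall s, (s0 <= s)%N -> f s a < 1).
Proof.
move=> n0 fc f0 C0 hC.
have /choice[mu hmu] s : exists mu, mean (f s) mu /\ mu <= c s.
  by have [mu ? ?] := fc s; exists mu.
apply: (@ae_eventually_lt1 _ _ f mu C) => // s; first by have [] := hmu s.
by apply: le_trans (hC s); rewrite ler_wpM2l //; have [] := hmu s.
Qed.
End MeanLe.

(** * Counting and summing over tuples of exponents *)

Section Counting.
Variable R : realType.

Lemma sum_ffun_prod (I X : finType) (Q : I -> pred X) (F : I -> X -> R) :
  \sum_(q : {ffun I -> X} | [forall i, Q i (q i)]) \prod_i F i (q i)
  = \prod_i \sum_(x | Q i x) F i x.
Proof.
rewrite bigA_distr_big_dep; apply: eq_bigl => q.
by apply/forallP/familyP => h i; have := h i.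
Qed.

Lemma sum_ffun_const (I X : finType) (Q : I -> pred X) :
  \sum_(q : {ffun I -> X} | [forall i, Q i (q i)]) 1
  = \prod_i \sum_(x | Q i x) 1 :> R.
Proof.
rewrite -(sum_ffun_prod Q (fun _ _ => 1)); apply: eq_bigr => q _.
by rewrite prodr_const expr1n.
Qed.

Lemma sum_ord_lt (N m : nat) : \sum_(x < N | (x < m)%N) 1 <= m%:R :> R.
Proof.
case: (leqP m N) => h.
  by rewrite -(big_ord_widen N (fun=> 1)) // sumr_const card_ord.
apply: (@le_trans _ _ (\sum_(x < N) 1)); first by rewrite big_mkcond; apply: ler_sum => x _; case: ifP.
by rewrite sumr_const card_ord ler_nat ltnW.
Qed.

Lemma prodr_exp2 (I : finType) (l : I -> nat) :
  \prod_i (2 ^ l i)%:R = 2 ^+ (\sum_i l i)%N :> R.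
Proof. by rewrite -natr_prod -expn_sum natrX. Qed.

(** The last [r] coordinates determine the first. The factor [B] saved over all tuples is what puts
    the deviations below the main term. *)
Lemma count_fixed_sum (r B t : nat) :
  \sum_(j : {ffun 'I_r.+1 -> 'I_B} | (\sum_k j k == t)%N) 1 <= B%:R ^+ r :> R.
Proof.
have -> : B%:R ^+ r = \sum_(j : {ffun 'I_r -> 'I_B}) 1 :> R.
  by rewrite sumr_const card_ffun !card_ord natrX.
apply: (@ler_sum_inj R {ffun 'I_r.+1 -> 'I_B} {ffun 'I_r -> 'I_B} _ _ _ _
  (fun j => [ffun i => j (lift ord0 i)])) => //.
move=> j j'; rewrite !unfold_in => /eqP hj /eqP hj' /ffunP e.
have e' i : j (lift ord0 i) = j' (lift ord0 i) by have := e i; rewrite !ffunE.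
have e0 : j ord0 = j' ord0.
  apply: val_inj => /=; move: hj hj'; rewrite !big_ord_recl.
  rewrite (eq_bigr (fun i => j' (lift ord0 i) : nat)) => [|i _]; last by rewrite e'.
  by move=> <- /addIn ->.
by apply/ffunP => k; case: (unliftP ord0 k) => [i ->|->].
Qed.

(** The geometric series over [t <= m] gives at most [2]; each of the [h] later terms is [1],
    because [m - t] is truncated to [0]. *)
Lemma sum_pow_sub (m h : nat) : \sum_(t < (m + h).+1) (2 : R) ^- (m - t) <= 2 + h%:R.
Proof.
have H0 : \sum_(t < m.+1) (2 : R) ^- (m - t) <= 2 - 2 ^- m.
  elim: m => [|m IH].
    by rewrite big_ord_recr big_ord0 /= subn0 expr0 invr1; lra.
  rewrite big_ord_recr /= subnn expr0 invr1.
  have -> : \sum_(i < m.+1) (2 : R) ^- (m.+1 - i) = 2^-1 * \sum_(i < m.+1) (2 : R) ^- (m - i).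
    rewrite mulr_sumr; apply: eq_bigr => i _.
    by rewrite subSn ?exprS ?invfM // -ltnS.
  by rewrite exprS invfM; lra.
elim: h => [|h IH]; first by rewrite addn0 addr0; apply: (le_trans H0); rewrite lerBlDr lerDl invr_ge0 exprn_ge0.
rewrite addnS big_ord_recr /= -[h.+1%:R]natr1 addrA lerD //.
have -> : (m - (m + h).+1 = 0)%N by lia.
by rewrite expr0 invr1.
Qed.

Lemma harmonic_le s : \sum_(x < 2 ^ s) (1 + x%:R)^-1 <= 1 + s%:R :> R.
Proof.
elim: s => [|s IH]; first by rewrite expn0 big_ord_recr big_ord0 /= addr0 add0r invr1.
rewrite expnS mul2n -addnn big_split_ord /= -[s.+1%:R]natr1 addrA lerD //.
apply: (@le_trans _ _ (\sum_(i < 2 ^ s) (2 ^ s)%:R^-1)).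
  apply: ler_sum => i _; rewrite lef_pV2 ?posrE ?ltr0n ?expn_gt0 //.
    by rewrite natrD; have : 0 <= i%:R :> R by []; lra.
by rewrite sumr_const card_ord -[_^-1 *+ _]mulr_natr mulVf // pnatr_eq0 -lt0n expn_gt0.
Qed.

(** Serves to move a tuple that is too large onto the single diagonal where [total < 1] gives a
    contradiction. *)
Lemma exists_le_sum (K : finType) (j : K -> nat) (m : nat) : (m <= \sum_k j k)%N ->
  exists2 j' : K -> nat, (forall k, j' k <= j k)%N & (\sum_k j' k)%N = m.
Proof.
move=> hm; have [d hd] : exists d, (\sum_k j k = m + d)%N by exists (\sum_k j k - m)%N; lia.
elim: d j {hm} hd => [|d IH] j hd; first by exists j => //; rewrite hd addn0.
have [k hk] : exists k, (0 < j k)%N.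
  apply: contrapT => H; move: hd; rewrite big1 => [|k _]; first by lia.
  by apply/eqP; rewrite -leqn0 leqNgt; apply/negP => h; apply: H; exists k.
have [|j' j'le j'sum] := IH (fun k' => if k' == k then (j k).-1 else j k').
  move: hd; rewrite (bigD1 k) //= => hd.
  rewrite (bigD1 k) //= eqxx (eq_bigr j) => [|k' /negPf -> //]; lia.
exists j' => // k'; have := j'le k'; case: eqP => [->|//]; lia.
Qed.
End Counting.

(** * Dyadic pieces *)

Section Scale.
Variables (R : realType) (n p r : nat).
Variables (e : 'I_p.+1 -> 'I_r.+1 -> 'I_n) (ei : 'I_n -> 'I_p.+1) (ek : 'I_n -> 'I_r.+1).
Hypothesis eK : forall x, e (ei x) (ek x) = x.
Hypothesis eiK : forall i k, ei (e i k) = i.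
Hypothesis ekK : forall i k, ek (e i k) = k.
Local Notation I := 'I_p.+1.
Local Notation K := 'I_r.+1.
Implicit Types (alpha : 'I_n -> R) (s : nat).

Definition mx alpha : I -> K -> R := fun i k => alpha (e i k).

Lemma sum_phi_mx alpha (q : I -> int) (m : K -> int) :
  \sum_i (q i)%:~R * phi (mx alpha) m i = \sum_x (q (ei x) * m (ek x))%:~R * alpha x.
Proof.
rewrite /phi /mx; under eq_bigr do rewrite mulr_sumr.
rewrite pair_bigA /= [RHS](reindex (fun ik => e ik.1 ik.2)) /=.
  by apply: eq_bigr => -[i k] _ /=; rewrite eiK ekK rmorphM /= mulrA.
exists (fun x => (ei x, ek x)) => [[i k] _|x _] /=; first by rewrite eiK ekK.
by rewrite eK.
Qed.

(** As functions of [alpha], the frequencies are the rank-one matrices [q i * z k]; for a non-zero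
    [q] such a matrix vanishes only when [z = 0]. *)
Lemma mean_psi (N : nat) (M : K -> nat) (q : I -> int) :
  (0 < N)%N -> (forall k, 0 < M k <= N)%N -> (exists i, q i != 0) ->
  mean_le (fun alpha => \prod_k fejer (M k) (psi (mx alpha) q k)) 1.
Proof.
move=> N0 MN [i qi].
apply: (@mean_le_prod_fejer _ _ _ N M (fun k alpha => psi (mx alpha) q k)
  (fun z x => q (ei x) * z (ek x))) => //.
  by move=> z a; rewrite psi_phi sum_phi_mx.
move=> z hz k; have := hz (e i k); rewrite eiK ekK => /eqP.
by rewrite mulf_eq0 (negPf qi) => /eqP.
Qed.

Lemma mean_phi (N : nat) (L : I -> nat) (m : K -> int) :
  (0 < N)%N -> (forall i, 0 < L i <= N)%N -> (exists k, m k != 0) ->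
  mean_le (fun alpha => \prod_i fejer (L i) (phi (mx alpha) m i)) 1.
Proof.
move=> N0 LN [k mk].
apply: (@mean_le_prod_fejer _ _ _ N L (fun i alpha => phi (mx alpha) m i)
  (fun z x => z (ei x) * m (ek x))) => //.
  by move=> z a; rewrite sum_phi_mx.
move=> z hz i; have := hz (e i k); rewrite eiK ekK => /eqP.
by rewrite mulf_eq0 (negPf mk) orbF => /eqP.
Qed.

Lemma mean_err (N : nat) (L : I -> nat) (M : K -> nat) :
  (0 < N)%N -> (forall i, 0 < L i <= N)%N -> (forall k, 0 < M k <= N)%N ->
  mean_le (fun alpha => err (mx alpha) N L M) (\prod_k (M k)%:R).
Proof.
move=> N0 LN MN; rewrite -(sum_wt R MN).
apply: (@mean_le_trans _ _ _ (\sum_(v : {ffun K -> bool * 'I_N} | ~~ [forall k, zi (v k) == 0])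
     wt R M v * 1)).
  rewrite big_mkcond; apply: ler_sum => v _.
  by case: ifP; rewrite ?mulr1 // wt_ge0.
apply: mean_le_sum => v /forallPn[k hk]; apply: mean_leZ; first exact: wt_ge0.
by apply: (@mean_phi N) => //; exists k.
Qed.

(* The number of dyadic scales at level [s], a power of [4] so that its square
   root is [2 ^ s]. *)
Definition nscale s := (4 ^ s)%N.
(** Chosen so that [2 ^ slack s] is at least [N ^ r * 2 ^ s * N ^ p.+1 * 2 ^ r.+1] for
    [N = nscale s]: one product of kernels of that excess then forces [total >= 1]. As
    [sz l <= p.+1 * N], every coordinate of a relevant [j] is below [jbound s]. *)
Definition slack s := (2 * (p.+1 + r.+1) * s.+1)%N.
Definition jbound s := (p.+1 * nscale s + slack s).+1.
Definition sz (T : finType) (l : T -> nat) := (\sum_i l i)%N.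

(** The factor [2] keeps [q i] in the half of the triangular window of order [2 ^ l i] where the
    weight is at least [1 / 2]. *)
Definition box s (l : I -> nat) (q : {ffun I -> 'I_(2 ^ nscale s).+1}) :=
  [exists i, q i != 0%N :> nat] && [forall i, (2 * q i <= 2 ^ l i)%N].

Definition nz (q : I -> nat) : I -> int := fun i => Posz (q i).

(* The pieces where [q i] has size about [2 ^ l i] and the [k]-th distance is about
   [2 ^- j k].  As long as [sz j <= sz l] the expected main term is subtracted, and
   the duality formula makes the rest small in mean; beyond that the main term is
   no longer dominant and the whole piece is kept. *)
Definition term s (l : I -> nat) (j : K -> nat) alpha : R :=
  2 ^- sz l * (if (sz j <= sz l)%N
    then err (mx alpha) (2 ^ jbound s) (fun i => 2 ^ l i)%N (fun k => 2 ^ j k)%N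
    else \sum_(q : {ffun I -> 'I_(2 ^ nscale s).+1} | box l q)
           \prod_k fejer (2 ^ j k) (psi (mx alpha) (nz (fun i => q i)) k)).

(** The diagonal [sz j = sz l + slack s] is included: a single large product on it is already
    incompatible with [total < 1], and this disposes of all the [j] beyond. *)
Definition block s (l : I -> nat) alpha : R :=
  \sum_(j : {ffun K -> 'I_(jbound s)} | (sz (fun k => j k) <= sz l + slack s)%N)
     term s l (fun k => j k) alpha.

(* The weights decrease in [l], so that one bound on [total] controls the sums of
   [block] over all boxes of [l] inside level [s]. *)
Definition total s alpha : R :=
  (nscale s)%:R ^- r * 2 ^- s *
  \sum_(l : {ffun I -> 'I_(nscale s)})
    (\prod_i (1 + (l i)%:R)^-1) * block s (fun i => l i) alpha.

Lemma prod_fejer_ge0 (J : finType) (L : J -> nat) (x : J -> R) : 0 <= \prod_j fejer (L j) (x j).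
Proof. by apply: prodr_ge0 => j _; exact: fejer_ge0. Qed.

Lemma term_ge0 s l j alpha : 0 <= term s l j alpha.
Proof.
rewrite mulr_ge0 ?invr_ge0 ?exprn_ge0 //; case: ifP => _; first exact: err_ge0.
by apply: sumr_ge0 => q _; exact: prod_fejer_ge0.
Qed.

Lemma block_ge0 s l alpha : 0 <= block s l alpha.
Proof. by apply: sumr_ge0 => j _; exact: term_ge0. Qed.

Lemma total_ge0 s alpha : 0 <= total s alpha.
Proof.
rewrite !mulr_ge0 ?invr_ge0 ?exprn_ge0 ?ler0n ?sumr_ge0 // => l _.
rewrite mulr_ge0 ?block_ge0 //; apply: prodr_ge0 => i _.
by rewrite invr_ge0; apply: addr_ge0.
Qed.

Lemma nscale_le_jbound s : (nscale s <= jbound s)%N.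
Proof. rewrite /jbound mulSn; lia. Qed.

Lemma pow_jbound s m : (m <= jbound s)%N -> (0 < 2 ^ m <= 2 ^ jbound s)%N.
Proof. by move=> h; rewrite expn_gt0 leq_exp2l. Qed.

Lemma sum_box s (l : I -> nat) :
  \sum_(q : {ffun I -> 'I_(2 ^ nscale s).+1} | box l q) (1 : R) <= 2 ^+ sz l.
Proof.
apply: (@le_trans _ _ (\sum_(q : {ffun I -> 'I_(2 ^ nscale s).+1} |
    [forall i, (q i < 2 ^ l i)%N]) 1)).
  rewrite [leLHS]big_mkcond [leRHS]big_mkcond; apply: ler_sum => q _ /=.
  case: ifP => [/andP[_ /forallP h]|_]; last by case: ifP.
  rewrite ifT //; apply/forallP => i; have := h i; have : (0 < 2 ^ l i)%N by rewrite expn_gt0.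
  lia.
rewrite (sum_ffun_const R (fun i (x : 'I_(2 ^ nscale s).+1) => (x < 2 ^ l i)%N)).
rewrite -prodr_exp2; apply: ler_prod => i _; rewrite sum_ord_lt andbT.
by apply: sumr_ge0.
Qed.

(** For [sz j <= sz l] the error has mean at most [2 ^ sz j], to be divided by [2 ^ sz l]. Otherwise
    at most [2 ^ sz l] vectors [q] contribute, each with mean at most [1], and truncated subtraction
    turns the stated bound into [1]. *)
Lemma mean_term s (l : {ffun I -> 'I_(nscale s)}) (j : {ffun K -> 'I_(jbound s)}) :
  mean_le (term s (fun i => l i) (fun k => j k))
    (2 ^- (sz (fun i => l i) - sz (fun k => j k))).
Proof.
have lb i : (0 < 2 ^ l i <= 2 ^ jbound s)%N.
  by apply: pow_jbound; apply: leq_trans (nscale_le_jbound s); exact: ltnW.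
have jb k : (0 < 2 ^ j k <= 2 ^ jbound s)%N by apply: pow_jbound; exact: ltnW.
have N0 : (0 < 2 ^ jbound s)%N by rewrite expn_gt0.
rewrite /term; have [h|h] := boolP (sz (fun k => j k) <= sz (fun i => l i))%N.
  apply: (@mean_le_trans _ _ _ (2 ^- sz (fun i => l i) * \prod_k (2 ^ j k)%:R)).
    have E : 2 ^+ sz (fun i => l i) = 2 ^+ (sz (fun i => l i) - sz (fun k => j k))
        * 2 ^+ sz (fun k => j k) :> R by rewrite -exprD subnK.
    by rewrite prodr_exp2 E invfM -mulrA mulVf ?mulr1 // expf_neq0.
  by apply: mean_leZ; rewrite ?invr_ge0 ?exprn_ge0 //; exact: mean_err.
have -> : (sz (fun i => l i) - sz (fun k => j k) = 0)%N by lia.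
rewrite expr0 invr1.
apply: (@mean_le_trans _ _ _ (2 ^- sz (fun i => l i) *
  \sum_(q : {ffun I -> 'I_(2 ^ nscale s).+1} | box (fun i => l i) q) 1)).
  by rewrite mulrC ler_pdivrMr ?exprn_gt0 // mul1r sum_box.
apply: mean_leZ; first by rewrite invr_ge0 exprn_ge0.
apply: mean_le_sum => q /andP[/existsP[i qi] _].
by apply: (mean_psi N0 jb); exists i.
Qed.

(** Group by [t = sz j]: each diagonal has at most [jbound s ^ r] tuples, and the factors
    [2 ^- (m - t)] add up to at most [2 + slack s]. *)
Lemma mean_block s (l : {ffun I -> 'I_(nscale s)}) :
  mean_le (block s (fun i => l i)) ((2 + (slack s)%:R) * (jbound s)%:R ^+ r).
Proof.
pose m := sz (fun i => l i).
apply: (@mean_le_trans _ _ _ (\sum_(j : {ffun K -> 'I_(jbound s)} |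
   (sz (fun k => j k) <= m + slack s)%N) 2 ^- (m - sz (fun k => j k)))); last first.
  by apply: mean_le_sum => j _; exact: mean_term.
apply: (@le_trans _ _ (\sum_(t < (m + slack s).+1) 2 ^- (m - t) * (jbound s)%:R ^+ r)); last first.
  by rewrite -mulr_suml ler_wpM2r ?exprn_ge0 // sum_pow_sub.
rewrite (partition_big (fun j : {ffun K -> 'I_(jbound s)} => inord (sz (fun k => j k)) : 'I_(m + slack s).+1) xpredT) //=.
apply: ler_sum => t _.
apply: (@le_trans _ _ (2 ^- (m - t) * \sum_(j : {ffun K -> 'I_(jbound s)} | (\sum_k j k == t)%N) 1)).
  rewrite mulr_sumr [leRHS]big_mkcond [leLHS]big_mkcond; apply: ler_sum => j _.
  case: ifP => [/andP[h1 /eqP h2]|_].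
    have h3 : sz (fun k => j k) = t by rewrite -h2 inordK.
    by rewrite ifT ?mulr1 ?h3 // -h3.
  by case: ifP; rewrite // mulr1 invr_ge0 exprn_ge0.
by rewrite ler_wpM2l ?invr_ge0 ?exprn_ge0 // count_fixed_sum.
Qed.

Lemma mean_total s : mean_le (total s)
  ((nscale s)%:R ^- r * 2 ^- s * ((1 + (2 * s)%:R) ^+ p.+1
     * ((2 + (slack s)%:R) * (jbound s)%:R ^+ r))).
Proof.
rewrite /total; apply: mean_leZ; first by rewrite mulr_ge0 ?invr_ge0 ?exprn_ge0.
set c := (_ + _) * _ ^+ r.
have c0 : 0 <= c by rewrite mulr_ge0 ?exprn_ge0 ?addr_ge0.
apply: (@mean_le_trans _ _ _ (\sum_(l : {ffun I -> 'I_(nscale s)})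
   (\prod_i (1 + (l i)%:R)^-1) * c)); last first.
  apply: mean_le_sum => l _; apply: mean_leZ; last exact: mean_block.
  by apply: prodr_ge0 => i _; rewrite invr_ge0 addr_ge0.
rewrite -mulr_suml ler_wpM2r //.
rewrite -(bigA_distr_bigA (fun (i : I) (x : 'I_(nscale s)) => (1 + x%:R)^-1 : R)).
rewrite prodr_const card_ord; apply: lerXn2r; rewrite ?nnegrE ?addr_ge0 //.
  by apply: sumr_ge0 => x _; rewrite invr_ge0 addr_ge0.
by rewrite /nscale -[4%N]/(2 ^ 2)%N -expnM harmonic_le.
Qed.

Lemma ae_total_lt1 : (0 < n)%N ->
  ae_Rn (fun alpha => exists s0, forall s, (s0 <= s)%N -> total s alpha < 1).
Proof.
move=> n0; pose c0 := (2 * (p.+1 + r.+1))%N.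
(* The exponent collects [n] for the volume of the cube, [p.+1] for the harmonic sums of the weights
   and [1] for [slack], while [jbound ^ r] is absorbed by [nscale ^- r]. Growth by [3 / 2] per level
   against [2 ^- s] leaves the ratio [3 / 4]. *)
have [C C0 hC] := poly_le_geom R (n + p.+2).
pose D : R := (p.+1 + c0 + 1)%:R ^+ r * (2 ^ n * 2 ^ p.+1 * (c0 + 2))%:R * C.
apply: (@ae_eventually_lt1_le _ _ _ _ D) n0 mean_total total_ge0 _ _.
  by rewrite !mulr_ge0 ?exprn_ge0.
move=> s; set N := nscale s.
have N0 : 0 < N%:R :> R by rewrite ltr0n expn_gt0.
have sN : (s.+1 <= N)%N by rewrite ltn_expl.
have hB : (jbound s)%:R <= (p.+1 + c0 + 1)%:R * N%:R :> R.
  rewrite -natrM ler_nat /jbound /slack -/c0 -/N !mulnDl mul1n.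
  have := leq_mul (leqnn c0) sN; lia.
have hS : 2 + (slack s)%:R <= (c0 + 2)%:R * s.+1%:R :> R.
  rewrite -natrM -natrD ler_nat /slack -/c0 mulnDl; lia.
have h2 : 1 + (2 * s)%:R <= 2 * s.+1%:R :> R by rewrite natrM -natr1; lra.
apply: (@le_trans _ _ ((2 * s.+1)%:R ^+ n * (N%:R ^- r * 2 ^- s *
   ((2 * s.+1%:R) ^+ p.+1 * ((c0 + 2)%:R * s.+1%:R * ((p.+1 + c0 + 1)%:R * N%:R) ^+ r))))).
  rewrite natrX ler_wpM2l ?exprn_ge0 // ler_wpM2l ?mulr_ge0 ?invr_ge0 ?exprn_ge0 //.
  apply: ler_pM; rewrite ?exprn_ge0 ?mulr_ge0 ?addr_ge0 ?exprn_ge0 //.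
    by apply: lerXn2r; rewrite // nnegrE ?addr_ge0 ?mulr_ge0.
  apply: ler_pM; rewrite ?exprn_ge0 ?mulr_ge0 ?addr_ge0 ?exprn_ge0 //.
  by apply: lerXn2r; rewrite // nnegrE ?addr_ge0 ?mulr_ge0.
have -> : (2 * s.+1)%:R ^+ n * (N%:R ^- r * 2 ^- s *
   ((2 * s.+1%:R) ^+ p.+1 * ((c0 + 2)%:R * s.+1%:R * ((p.+1 + c0 + 1)%:R * N%:R) ^+ r)))
  = (p.+1 + c0 + 1)%:R ^+ r * (2 ^ n * 2 ^ p.+1 * (c0 + 2))%:R
    * (s.+1%:R ^+ (n + p.+2) * 2 ^- s) :> R.
  rewrite !natrM !exprMn !natrX exprD [s.+1%:R ^+ p.+2]exprS.
  set a := _ ^+ r; set b := 2 ^- s; set c := 2 ^+ n; set d := 2 ^+ p.+1.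
  set f := (c0 + 2)%:R; set g := s.+1%:R ^+ p.+1; set x := s.+1%:R; set y := x ^+ n.
  field.
  by rewrite expf_neq0 // lt0r_neq0.
rewrite /D -[leRHS]mulrA ler_wpM2l ?mulr_ge0 ?exprn_ge0 //.
rewrite ler_pdivrMr ?exprn_gt0 // -mulrA -exprMn.
by have -> : 3 / 4 * 2 = 3 / 2 :> R by lra.
Qed.
End Scale.

(** * Upper and lower bounds *)

Section Pointwise.
Variables (R : realType) (n p r : nat) (e : 'I_p.+1 -> 'I_r.+1 -> 'I_n).
Local Notation I := 'I_p.+1.
Local Notation K := 'I_r.+1.
Variables (s : nat) (alpha : 'I_n -> R).
Hypothesis total_lt1 : total e s alpha < 1.
Local Notation N := (nscale s).
Local Notation A := (mx e alpha).

Lemma nscaleE : N = (2 ^ (2 * s))%N.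
Proof. by rewrite /nscale expnM. Qed.

Lemma nscale_gt0 : (0 < N)%N.
Proof. by rewrite expn_gt0. Qed.

Lemma blocks_le (Q : pred {ffun I -> 'I_N}) (b : R) : 0 <= b ->
  (forall l, Q l -> \prod_i (1 + (l i)%:R) <= b) ->
  \sum_(l | Q l) block e s (fun i => l i) alpha <= b * (N%:R ^+ r * 2 ^+ s).
Proof.
move=> b0 hQ; have N0 : 0 < N%:R :> R by rewrite ltr0n nscale_gt0.
apply: (@le_trans _ _ (b * \sum_(l : {ffun I -> 'I_N})
    (\prod_i (1 + (l i)%:R)^-1) * block e s (fun i => l i) alpha)).
  rewrite mulr_sumr [leLHS]big_mkcond; apply: ler_sum => l _.
  have B0 := block_ge0 e s (fun i => l i) alpha.
  have P0 : 0 < \prod_i (1 + (l i)%:R) :> R by apply: prodr_gt0 => i _; apply: ltr_pwDl.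
  case: ifP => Ql; last first.
    by rewrite mulr_ge0 // mulr_ge0 // prodfV invr_ge0 ltW.
  by rewrite mulrA ler_peMl // prodfV ler_pdivlMr // mul1r hQ.
rewrite ler_wpM2l // -[leRHS]mul1r -ler_pdivrMr ?mulr_gt0 ?exprn_gt0 //.
by rewrite mulrC invfM ltW.
Qed.

(** Otherwise this one [q] would make [term] at least [2 ^ slack / 2 ^ r.+1], which outweighs the
    normalisation of [total] even when the weight of [l] is as small as [N ^- p.+1]. *)
Lemma prod_fejer_lt (l : {ffun I -> 'I_N}) (j : K -> nat)
    (q : {ffun I -> 'I_(2 ^ N).+1}) :
  sz j = (sz (fun i => l i) + slack p r s)%N -> box (fun i => l i) q ->
  \prod_k fejer (2 ^ j k) (psi A (nz (fun i => q i)) k) < 2 ^+ sz j / 2 ^+ r.+1.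
Proof.
move=> hj hq; rewrite ltNge; apply/negP => h.
have N0 : 0 < N%:R :> R by rewrite ltr0n nscale_gt0.
have jB k : (j k < jbound p r s)%N.
  rewrite ltnS; apply: (@leq_trans (sz j)); first by rewrite /sz (bigD1 k) // leq_addr.
  rewrite hj leq_add2r /sz; apply: (@leq_trans (\sum_(i : I) N)).
    by apply: leq_sum => i _; exact: ltnW.
  by rewrite sum_nat_const card_ord.
pose j' : {ffun K -> 'I_(jbound p r s)} := [ffun k => inord (j k)].
have j'E : (fun k => j' k : nat) = j by apply/funext => k; rewrite ffunE inordK.
have T1 : 2 ^+ slack p r s / 2 ^+ r.+1 <= term e s (fun i => l i) j alpha.
  rewrite /term ifF; last by rewrite hj; apply/negbTE; rewrite -ltnNge -addn1 leq_add2l /slack muln_gt0.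
  rewrite ler_pdivlMl ?exprn_gt0 // mulrA -exprD -hj.
  apply: (le_trans h); rewrite (bigD1 q) //= lerDl.
  by apply: sumr_ge0 => q' _; exact: prod_fejer_ge0.
have T2 : term e s (fun i => l i) j alpha <= block e s (fun i => l i) alpha.
  rewrite /block (bigD1 j') /= ?j'E ?hj // lerDl.
  by apply: sumr_ge0 => j'' _; exact: term_ge0.
have T3 : (N%:R ^+ p.+1)^-1 * block e s (fun i => l i) alpha
    <= \sum_(l : {ffun I -> 'I_N}) (\prod_i (1 + (l i)%:R)^-1) * block e s (fun i => l i) alpha.
  rewrite (bigD1 l) //= -[leLHS]addr0 lerD //.
    rewrite ler_wpM2r ?block_ge0 // prodfV lef_pV2 ?posrE ?exprn_gt0 //.
      have -> : N%:R ^+ p.+1 = \prod_(i : I) N%:R :> R by rewrite prodr_const card_ord.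
      by apply: ler_prod => i _; rewrite addr_ge0 //= nat1r ler_nat.
    by apply: prodr_gt0 => i _; apply: ltr_pwDl.
  apply: sumr_ge0 => l' _; rewrite mulr_ge0 ?block_ge0 //.
  by apply: prodr_ge0 => i _; rewrite invr_ge0; exact: addr_ge0.
have T4 : 1 <= N%:R ^- r * 2 ^- s * ((N%:R ^+ p.+1)^-1 * (2 ^+ slack p r s / 2 ^+ r.+1)) :> R.
  have -> : N%:R ^- r * 2 ^- s * ((N%:R ^+ p.+1)^-1 * (2 ^+ slack p r s / 2 ^+ r.+1))
     = 2 ^+ slack p r s / 2 ^+ (2 * s * r + s + 2 * s * p.+1 + r.+1) :> R.
    rewrite nscaleE natrX -!exprM !exprD !invfM; ring.
  rewrite ler_pdivlMr ?exprn_gt0 // mul1r ler_weXn2l ?ler1n // /slack.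
  by rewrite !mulnDr !mulnDl; lia.
have : total e s alpha < total e s alpha.
  apply: (lt_le_trans total_lt1); apply: (le_trans T4).
  rewrite ler_wpM2l ?mulr_ge0 ?invr_ge0 ?exprn_ge0 //.
  by apply: le_trans T3; rewrite ler_wpM2l ?invr_ge0 ?exprn_ge0 // (le_trans T1).
by rewrite ltxx.
Qed.

(** The exponents [j k] come from [inv_distZ_le]. If their sum exceeded [m], lowering them to sum
    exactly [m] would keep the lower bounds [2 ^ i / 2] on the kernels, contrary to [prod_fejer_lt].
    A vanishing distance would give [j k > m] and is excluded in the same way. *)
Lemma pointwise (l : {ffun I -> 'I_N}) (q : {ffun I -> 'I_(2 ^ N).+1}) :
  box (fun i => l i) q ->
  (forall k, 0 < distZ (psi A (nz (fun i => q i)) k)) /\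
  exists2 j : {ffun K -> 'I_(jbound p r s)},
    (sz (fun k => j k) <= sz (fun i => l i) + slack p r s)%N
    & \prod_k (distZ (psi A (nz (fun i => q i)) k))^-1
      <= 32 ^+ r.+1 * \prod_k fejer (2 ^ j k) (psi A (nz (fun i => q i)) k).
Proof.
move=> hq; set x := psi A _; set m := (sz (fun i => l i) + slack p r s)%N.
have /choice[j hj] k := inv_distZ_le (x k) m.
have jm : (sz j <= m)%N.
  rewrite leqNgt; apply/negP => h.
  have [j' j'le j'm] := exists_le_sum (ltnW h).
  have := prod_fejer_lt j'm hq; rewrite ltNge => /negP; apply.
  have -> : 2 ^+ sz j' / 2 ^+ r.+1 = \prod_k (2 ^+ j' k / 2) :> R.
    rewrite big_split /= prodr_const card_ord exprVn; congr (_ / _).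
    by rewrite -prodr_exp2; apply: eq_bigr => k _; rewrite natrX.
  apply: ler_prod => k _; rewrite divr_ge0 ?exprn_ge0 //=.
  by have [h1 _ _] := hj k; exact: h1.
have jk k : (j k <= m)%N by apply: leq_trans jm; rewrite /sz (bigD1 k) //= leq_addr.
split.
  move=> k; rewrite lt_def distZ_ge0 andbT; apply/eqP => h.
  by have [_ _ /(_ h)] := hj k; rewrite ltnNge jk.
have jB k : (j k < jbound p r s)%N.
  rewrite ltnS; apply: (leq_trans (jk k)); rewrite leq_add2r /sz.
  apply: (@leq_trans (\sum_(i : I) N)); first by apply: leq_sum => i _; exact: ltnW.
  by rewrite sum_nat_const card_ord.
pose j' : {ffun K -> 'I_(jbound p r s)} := [ffun k => inord (j k)].
have j'E k : j' k = j k :> nat by rewrite ffunE inordK.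
exists j'; first by rewrite /sz; under eq_bigr do rewrite j'E.
have -> : 32 ^+ r.+1 = \prod_(k : K) 32 :> R by rewrite prodr_const card_ord.
rewrite -big_split /=; apply: ler_prod => k _; rewrite invr_ge0 distZ_ge0 /= j'E.
by have [_ h2 _] := hj k.
Qed.

Definition recip (q : I -> nat) : R :=
  ((\prod_i (maxn 1 (q i))%:R) * \prod_k distZ (psi A (nz q) k))^-1.

Lemma recip_ge0 q : 0 <= recip q.
Proof.
rewrite invr_ge0 mulr_ge0 //; first by apply: prodr_ge0.
by apply: prodr_ge0 => k _; exact: distZ_ge0.
Qed.

Definition gsum (Q : nat) (T : I -> nat) : R :=
  \sum_(q : {ffun I -> 'I_Q.+1} | [exists i, (q i != 0%N :> nat)] && [forall i, (q i <= T i)%N])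
     recip (fun i => q i).

Lemma gsum_widen Q Q' T : (forall i, T i <= Q')%N -> gsum Q T <= gsum Q' T.
Proof.
move=> TQ.
have H (q : {ffun I -> 'I_Q.+1}) : [forall i, (q i <= T i)%N] ->
    forall i, ([ffun i => inord (q i)] : {ffun I -> 'I_Q'.+1}) i = q i :> nat.
  by move=> /forallP hq i; rewrite ffunE inordK // ltnS (leq_trans (hq i)).
apply: (@ler_sum_inj R {ffun I -> 'I_Q.+1} {ffun I -> 'I_Q'.+1} _ _ _ _
  (fun q => [ffun i => inord (q i)])).
- move=> q q'; rewrite !unfold_in => /andP[_ hq] /andP[_ hq'] eqq.
  by apply/ffunP => i; apply: val_inj; rewrite /= -H // -[RHS]H // eqq.
- move=> q /andP[/existsP[i qi] hq]; apply/andP; split.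
    by apply/existsP; exists i; rewrite H.
  by apply/forallP => k; rewrite H //; exact: (forallP hq).
- move=> q /andP[_ hq]; rewrite le_eqVlt; apply/orP; left; apply/eqP; congr recip.
  by apply/funext => i; rewrite H.
- by move=> q _; exact: recip_ge0.
Qed.

(** On the half window each factor of [wt] is at least [1 / 2], and the remaining terms are
    non-negative. *)
Lemma fold_half (NU : nat) (L : I -> nat) (Q : nat) (G : (I -> int) -> R) :
  (forall i, 0 < L i <= NU)%N -> (forall z, 0 <= G z) ->
  \sum_(q : {ffun I -> 'I_Q.+1} | [forall i, (2 * q i <= L i)%N]) G (nz (fun i => q i))
  <= 2 ^+ p.+1 * \sum_(u : {ffun I -> bool * 'I_NU}) wt R L u * G (fun i => zi (u i)).
Proof.
case: NU => [|NU] LN G0; first by have := LN ord0; lia.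
rewrite mulr_sumr.
have H (q : {ffun I -> 'I_Q.+1}) : [forall i, (2 * q i <= L i)%N] -> forall i,
    zi (([ffun i => (false, inord (q i))] : {ffun I -> bool * 'I_NU.+1}) i) = q i.
  move=> /forallP hq i; rewrite ffunE /zi /= inordK //.
  by have := hq i; have := LN i; lia.
apply: (@ler_sum_inj R {ffun I -> 'I_Q.+1} {ffun I -> bool * 'I_NU.+1} _ _ _ _
  (fun q => [ffun i => (false, inord (q i))])) => //.
- move=> q q'; rewrite !unfold_in => hq hq' eqq.
  apply/ffunP => i; apply: val_inj => /=.
  by apply/eqP; rewrite -eqz_nat -(H _ hq) -(H _ hq') eqq.
- move=> q hq; have -> : (fun i => zi (([ffun i => (false, inord (q i))] : {ffun I -> bool * 'I_NU.+1}) i)) = nz (fun i => q i).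
    by apply/funext => i; rewrite H.
  rewrite mulrA ler_peMl //.
  have -> : 2 ^+ p.+1 = \prod_(i : I) 2 :> R by rewrite prodr_const card_ord.
  rewrite /wt -big_split /=.
  apply: (@le_trans _ _ (\prod_(i : I) 1)); first by rewrite prodr_const expr1n.
  apply: ler_prod => i _; rewrite ler01 /=.
  rewrite H //; have /andP[L0 _] := LN i.
  have : 2^-1 <= tri R (L i) (q i) by apply: tri_half => //; exact: (forallP hq).
  lra.
- by move=> u _; rewrite mulr_ge0 ?mulr_ge0 ?wt_ge0 ?exprn_ge0.
Qed.

(** The boolean is the main term after division by [2 ^ sz l]: it is [1] while [term] is an error
    and [0] once [term] is the full sum. *)
Lemma term_ge (l : {ffun I -> 'I_N}) (j : {ffun K -> 'I_(jbound p r s)}) :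
  2 ^- sz (fun i => l i) * \sum_(q : {ffun I -> 'I_(2 ^ N).+1} | box (fun i => l i) q)
     \prod_k fejer (2 ^ j k) (psi A (nz (fun i => q i)) k)
  <= 2 ^+ p.+1 * ((sz (fun k => j k) <= sz (fun i => l i))%N%:R
      + term e s (fun i => l i) (fun k => j k) alpha).
Proof.
have lb i : (0 < 2 ^ l i <= 2 ^ jbound p r s)%N.
  by apply: pow_jbound; apply: leq_trans (nscale_le_jbound _ _ _); exact: ltnW.
have jb k : (0 < 2 ^ j k <= 2 ^ jbound p r s)%N by apply: pow_jbound; exact: ltnW.
have T0 := term_ge0 e s (fun i => l i) (fun k => j k) alpha.
rewrite /term; have [h|h] := boolP (sz (fun k => j k) <= sz (fun i => l i))%N; last first.
  rewrite add0r ler_peMl ?exprn_ege1 ?ler1n // mulr_ge0 ?invr_ge0 ?exprn_ge0 //.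
  by apply: sumr_ge0 => q _; exact: prod_fejer_ge0.
have E : 1 + 2 ^- sz (fun i => l i) * err A (2 ^ jbound p r s) (fun i => 2 ^ l i)%N (fun k => 2 ^ j k)%N
  = 2 ^- sz (fun i => l i) * (\prod_i (2 ^ l i)%:R + err A (2 ^ jbound p r s) (fun i => 2 ^ l i)%N (fun k => 2 ^ j k)%N).
  by rewrite mulrDr prodr_exp2 mulVf // expf_neq0.
rewrite E mulrCA ler_wpM2l ?invr_ge0 ?exprn_ge0 //.
pose G z := \prod_k fejer (2 ^ j k) (psi A z k).
apply: (@le_trans _ _ (\sum_(q : {ffun I -> 'I_(2 ^ N).+1} | [forall i, (2 * q i <= 2 ^ l i)%N]) G (nz (fun i => q i)))).
  rewrite [leLHS]big_mkcond [leRHS]big_mkcond; apply: ler_sum => q _ /=.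
  rewrite /box; case: ([forall i, _]); rewrite ?andbF // andbT.
  by case: ifP => _ //; exact: prod_fejer_ge0.
have G0 z : 0 <= G z by exact: prod_fejer_ge0.
apply: (le_trans (fold_half _ lb G0)); rewrite ler_wpM2l ?exprn_ge0 //.
have N0 : (0 < 2 ^ jbound p r s)%N by rewrite expn_gt0.
have := sum_fejer_approx A (fun=> 0) N0 lb jb.
rewrite (eq_bigr (fun u => wt R (fun i => 2 ^ l i)%N u * G (fun i => zi (u i)))) => [|u _].
  by move/ler_normlW; rewrite lerBlDl addrC.
congr (_ * _); apply: eq_bigr => k _; congr fejer; congr psi.
by apply/funext => i; rewrite add0r.
Qed.

(** Each [q] is put in the box with [l i = trunc_log 2 (q i) + 2], for which
    [2 * q i <= 2 ^ l i <= 4 * max 1 (q i)]; hence [4 ^ p.+1]. Replacing inverse distances by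
    kernels costs [32 ^ r.+1], and passing to triangular weights costs [2 ^ p.+1]. In the last
    factor the first summand counts the [j] with [sz j <= sz l]; the second bounds the
    deviations. *)
Lemma gsum_upper (T t : I -> nat) :
  (forall i, T i < 2 ^ (t i).+1)%N -> (forall i, (t i).+2 < N)%N ->
  gsum (2 ^ N) T <= 4 ^+ p.+1 * 32 ^+ r.+1 * 2 ^+ p.+1 * (\prod_i (t i).+3%:R
    * ((sz t + 2 * p.+1).+1%:R ^+ r.+1 + N%:R ^+ r * 2 ^+ s)).
Proof.
move=> Tt tN; set c := 4 ^+ p.+1 * 32 ^+ r.+1.
have c0 : 0 <= c by rewrite mulr_ge0 ?exprn_ge0.
pose g (q : {ffun I -> 'I_(2 ^ N).+1}) (l : {ffun I -> 'I_N}) (j : {ffun K -> 'I_(jbound p r s)}) : R :=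
  if box (fun i => l i) q then
   c * (2 ^- sz (fun i => l i) * \prod_k fejer (2 ^ j k) (psi A (nz (fun i => q i)) k)) else 0.
have g0 q l j : 0 <= g q l j.
  rewrite /g; case: ifP => // _.
  by rewrite mulr_ge0 // mulr_ge0 ?invr_ge0 ?exprn_ge0 ?prod_fejer_ge0.
pose Pl (l : {ffun I -> 'I_N}) := [forall i, (l i < (t i).+3)%N].
pose Pj (l : {ffun I -> 'I_N}) (j : {ffun K -> 'I_(jbound p r s)}) :=
  (sz (fun k => j k) <= sz (fun i => l i) + slack p r s)%N.
apply: (@le_trans _ _ (\sum_q \sum_(l | Pl l) \sum_(j | Pj l j) g q l j)).
  rewrite /gsum [leLHS]big_mkcond; apply: ler_sum => q _.
  have S0 : 0 <= \sum_(l | Pl l) \sum_(j | Pj l j) g q l j.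
    by apply: sumr_ge0 => l _; apply: sumr_ge0.
  case: ifP => // /andP[qnz /forallP qT].
  have lq i : (trunc_log 2 (q i) <= t i)%N.
    case: (posnP (q i)) => [->|qp]; first by rewrite trunc_log0.
    rewrite -ltnS -(@ltn_exp2l 2) //; apply: leq_ltn_trans (Tt i).
    exact: leq_trans (trunc_logP _ qp) (qT i).
  have lN i : ((trunc_log 2 (q i)).+2 < N)%N.
    by apply: leq_ltn_trans (tN i); rewrite !ltnS.
  pose l : {ffun I -> 'I_N} := [ffun i => Ordinal (lN i)].
  have lE i : l i = (trunc_log 2 (q i)).+2 :> nat by rewrite ffunE.
  have hb : box (fun i => l i) q.
    rewrite /box qnz; apply/forallP => i; rewrite lE expnS leq_mul2l /=.
    exact/ltnW/trunc_log_ltn.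
  have [_ [j jl hj]] := pointwise hb.
  rewrite (bigD1 l) /=; last by apply/forallP => i; rewrite lE !ltnS lq.
  rewrite (bigD1 j) //=; apply: (@le_trans _ _ (g q l j)); last first.
    rewrite -addrA lerDl addr_ge0 //; first by apply: sumr_ge0.
    by apply: sumr_ge0 => l' _; apply: sumr_ge0.
  rewrite /g hb /recip invfM -prodfV -prodfV /c mulrACA.
  apply: ler_pM => //.
  - by apply: prodr_ge0 => i _; rewrite invr_ge0.
  - by apply: prodr_ge0 => k _; rewrite invr_ge0 distZ_ge0.
  rewrite -prodr_exp2 -prodfV -[X in 4 ^+ X]card_ord -prodr_const -big_split /=.
  apply: ler_prod => i _; rewrite invr_ge0 ler0n /=.
  have q1 : (0 < maxn 1 (q i))%N by rewrite leq_max.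
  rewrite ler_pdivlMr ?ltr0n ?expn_gt0 // mulrC ler_pdivrMr ?ltr0n //.
  rewrite -natrM ler_nat lE !expnS mulnA leq_mul2l /=.
  case: (posnP (q i)) => [->|qp]; first by rewrite trunc_log0.
  by rewrite (maxn_idPr qp) trunc_logP.
rewrite exchange_big /=.
apply: (@le_trans _ _ (\sum_(l | Pl l) \sum_(j | Pj l j) c * (2 ^+ p.+1 *
   ((sz (fun k => j k) <= sz (fun i => l i))%N%:R + term e s (fun i => l i) (fun k => j k) alpha)))).
  apply: ler_sum => l _; rewrite exchange_big /=; apply: ler_sum => j _.
  rewrite /g -big_mkcond /= -mulr_sumr -mulr_sumr ler_wpM2l //; exact: term_ge.
rewrite (eq_bigr (fun l : {ffun I -> 'I_N} => c * 2 ^+ p.+1 * (\sum_(j | Pj l j)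
    (sz (fun k => j k) <= sz (fun i => l i))%N%:R + block e s (fun i => l i) alpha))); last first.
  move=> l _; rewrite /block -big_split /= mulr_sumr; apply: eq_bigr => j _.
  by rewrite mulrA.
rewrite -mulr_sumr ler_wpM2l ?mulr_ge0 ?exprn_ge0 // big_split /= mulrDr lerD //.
  have Pl1 : \sum_(l | Pl l) 1 <= \prod_i (t i).+3%:R :> R.
    rewrite /Pl (sum_ffun_const R (fun i (x : 'I_N) => (x < (t i).+3)%N)).
    by apply: ler_prod => i _; rewrite sum_ord_lt andbT; apply: sumr_ge0.
  apply: (@le_trans _ _ (\sum_(l | Pl l) 1 * (sz t + 2 * p.+1).+1%:R ^+ r.+1)); last first.
    by rewrite -mulr_suml ler_wpM2r ?exprn_ge0.
  apply: ler_sum => l /forallP Pll; rewrite mul1r.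
  have lt : (sz (fun i => l i) <= sz t + 2 * p.+1)%N.
    apply: (@leq_trans (\sum_i (t i + 2))); last first.
      by rewrite big_split /= sum_nat_const card_ord mulnC.
    by apply: leq_sum => i _; rewrite addn2 -ltnS.
  apply: (@le_trans _ _ (\sum_(j : {ffun K -> 'I_(jbound p r s)} |
      [forall k, (j k < (sz t + 2 * p.+1).+1)%N]) 1)).
    rewrite [leLHS]big_mkcond [leRHS]big_mkcond; apply: ler_sum => j _.
    case: (leqP (sz (fun k => j k)) (sz (fun i => l i))) => h; last by do 2!case: ifP.
    rewrite [X in _ <= X]ifT; first by case: ifP.
    apply/forallP => k; rewrite ltnS; apply: leq_trans lt; apply: leq_trans h.
    by rewrite /sz (bigD1 k) //= leq_addr.
  rewrite (sum_ffun_const R (fun (k : K) (x : 'I_(jbound p r s)) => (x < (sz t + 2 * p.+1).+1)%N)).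
  rewrite -[X in _ <= _ ^+ X]card_ord -prodr_const; apply: ler_prod => k _.
  by rewrite sum_ord_lt andbT; apply: sumr_ge0.
apply: blocks_le; first by apply: prodr_ge0.
move=> l /forallP Pll; apply: ler_prod => i _.
by rewrite addr_ge0 //= nat1r ler_nat.
Qed.
End Pointwise.

(** * The lower bound, from disjoint translated windows *)

Section Lower.
Variables (R : realType) (n p r : nat) (e : 'I_p.+1 -> 'I_r.+1 -> 'I_n).
Local Notation I := 'I_p.+1.
Local Notation K := 'I_r.+1.
Variables (s : nat) (alpha : 'I_n -> R).
Hypothesis total_lt1 : total e s alpha < 1.
Local Notation N := (nscale s).
Local Notation A := (mx e alpha).

(** Restricting each [l i] to the upper half of its range costs a factor [2] and makes
    [sz (2 l) >= sz tau - p.+1], so that one range of [j] suits all these [l]. *)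
Lemma count_upper_half (m tau : nat) : (tau <= m)%N ->
  tau%:R / 2 <= \sum_(x < m | (x < tau)%N && (tau <= 2 * x + 1)%N) 1 :> R.
Proof.
case: m => [|m] tm.
  by have -> : tau = 0%N by [lia]; rewrite mul0r; apply: sumr_ge0.
apply: (@le_trans _ _ (\sum_(y < tau - tau./2) 1)).
  rewrite sumr_const card_ord ler_pdivrMr // -natrM ler_nat.
  have := odd_double_half tau; lia.
apply: (@ler_sum_inj R 'I_(tau - tau./2) 'I_m.+1 _ _ _ _ (fun y => inord (tau./2 + y))) => //.
- have E (y : 'I_(tau - tau./2)) : (tau./2 + y < m.+1)%N by have := ltn_ord y; lia.
  by move=> x y _ _ /(congr1 val) /=; rewrite !inordK // => /addnI /val_inj.
- move=> y _; rewrite inordK; have := ltn_ord y; have := odd_double_half tau; lia.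
Qed.

(* The blocks [4 ^ l, 3 * 4 ^ l - 2] are disjoint for distinct [l], and [blk] is
   the translate of a triangular window of width [4 ^ l] onto such a block. *)
Definition blk (l : I -> nat) (z : I -> int) : I -> int :=
  fun i => (2 * (2 ^ (2 * l i))%N - 1)%:Z + z i.

Lemma blkP (l : I -> nat) (z : I -> int) (i : I) : (`|z i| < 2 ^ (2 * l i))%N ->
  [/\ (absz (blk l z i))%:Z = blk l z i, (2 ^ (2 * l i) <= `|blk l z i|)%N
    & (`|blk l z i| <= 3 * 2 ^ (2 * l i) - 2)%N].
Proof. by rewrite /blk; move: (2 ^ _)%N => L h; split; lia. Qed.

(** Only the [q] in the disjoint windows [blk] are kept. Bounding an inverse distance below by a sum
    of kernels costs [24], and [q i <= 3 * 4 ^ l i] costs [3]. Duality with a translation then gives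
    a main term [1] for each pair of [l] and [j], up to the deviations that are subtracted. *)
Lemma gsum_lower (T tau : I -> nat) :
  (forall i, 0 < tau i)%N -> (forall i, 2 * tau i + 1 < N)%N ->
  (forall i l, (l < tau i)%N -> (3 * 4 ^ l - 2 <= T i)%N) ->
  (forall i, T i <= 2 ^ N)%N ->
  \prod_i (tau i)%:R * (2 ^- p.+1 * ((sz tau - p.+1).+1%:R / r.+1%:R) ^+ r.+1
     - 2 ^+ p.+1 * (N%:R ^+ r * 2 ^+ s))
  <= 3 ^+ p.+1 * 24 ^+ r.+1 * gsum e alpha (2 ^ N) T.
Proof.
move=> tau0 tauN tauT TN.
pose Ql (l : {ffun I -> 'I_N}) := [forall i, (l i < tau i)%N && (tau i <= 2 * l i + 1)%N].
pose L (l : {ffun I -> 'I_N}) (i : I) := (2 ^ (2 * l i))%N.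
pose NU := (2 ^ jbound p r s)%N.
have NU0 : (0 < NU)%N by rewrite expn_gt0.
have lN l i : Ql l -> (2 * l i + 3 < N)%N.
  by move=> /forallP /(_ i) /andP[h _]; have := tauN i; lia.
have LNU l i : Ql l -> (0 < L l i <= NU)%N.
  move=> /lN h; rewrite /L /NU; apply: pow_jbound.
  by apply: leq_trans (nscale_le_jbound _ _ _); have := h i; lia.
(* If all [j k < J], then [sz j <= sz tau - p.+1 <= sz (2 l)] for [l] in [Ql], which is the range
   where [term] is an error. *)
pose J := ((sz tau - p.+1) %/ r.+1).+1.
have JB : (J <= jbound p r s)%N.
  rewrite /J /jbound ltnS; apply: leq_trans (leq_div _ _) _; apply: leq_trans (leq_subr _ _) _.
  apply: leq_trans (leq_addr _ _); apply: (@leq_trans (\sum_(i : I) N)).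
    by apply: leq_sum => i _; have := tauN i; lia.
  by rewrite sum_nat_const card_ord.
pose D : R := 3 ^+ p.+1 * 24 ^+ r.+1.
have D0 : 0 < D by rewrite mulr_gt0 ?exprn_gt0.
pose h (lu : {ffun I -> 'I_N} * {ffun I -> bool * 'I_NU}) : {ffun I -> 'I_(2 ^ N).+1} :=
  [ffun i => inord `|blk (fun i => lu.1 i) (fun i => zi (lu.2 i)) i|].
pose P (lu : {ffun I -> 'I_N} * {ffun I -> bool * 'I_NU}) := Ql lu.1 && (0 < wt R (L lu.1) lu.2).
have PE lu i : P lu -> [/\ (h lu i : nat) = blk (fun i => lu.1 i) (fun i => zi (lu.2 i)) i :> int,
     (4 ^ lu.1 i <= h lu i)%N, (h lu i < 4 ^ (lu.1 i).+1)%N & (h lu i <= T i)%N].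
  move=> /andP[hQ /wt_gt0 hw].
  have [b1 b2 b3] := @blkP (fun i => lu.1 i) (fun i => zi (lu.2 i)) i (hw i).
  have four : (4 ^ lu.1 i = 2 ^ (2 * lu.1 i))%N by rewrite expnM.
  have := tauT i (lu.1 i); have /forallP /(_ i) /andP[h1 h2] := hQ; move=> /(_ h1) h3.
  have hE : h lu i = absz (blk (fun i => lu.1 i) (fun i => zi (lu.2 i)) i) :> nat.
    rewrite ffunE inordK //; have := TN i; lia.
  split; rewrite hE ?four //; last by lia.
  rewrite expnS four; have : (0 < 2 ^ (2 * lu.1 i))%N by rewrite expn_gt0.
  lia.
have step1 : \sum_(lu | P lu) recip e alpha (fun i => h lu i) <= gsum e alpha (2 ^ N) T.
  apply: (@ler_sum_inj R _ _ _ _ _ _ h) => //.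
  - move=> lu lu'; rewrite !unfold_in => Plu Plu' eqh.
    have e1 : lu.1 = lu'.1.
      apply/ffunP => i; apply: val_inj => /=.
      have [_ a1 a2 _] := PE _ i Plu; have [_ b1 b2 _] := PE _ i Plu'.
      have t1 : trunc_log 4 (h lu i) = lu.1 i by apply: trunc_log_eq; rewrite ?a1 ?a2.
      have t2 : trunc_log 4 (h lu' i) = lu'.1 i by apply: trunc_log_eq; rewrite ?b1 ?b2.
      by rewrite -t1 -t2 eqh.
    have e2 : lu.2 = lu'.2.
      apply/ffunP => i; apply: zi_inj.
      have [a1 _ _ _] := PE _ i Plu; have [b1 _ _ _] := PE _ i Plu'.
      by move: a1; rewrite eqh b1 /blk e1 => /addrI.
    by case: (lu) (lu') e1 e2 => [? ?] [? ?] /= -> ->.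
  - move=> lu Plu; apply/andP; split.
      apply/existsP; exists ord0; have [_ b _ _] := PE _ ord0 Plu.
      by rewrite -lt0n; apply: leq_trans b; rewrite expn_gt0.
    by apply/forallP => i; have [_ _ _ b] := PE _ i Plu.
  - by move=> q _; exact: recip_ge0.
pose S (l : {ffun I -> 'I_N}) (u : {ffun I -> bool * 'I_NU}) : R :=
  wt R (L l) u * \prod_k \sum_(j < jbound p r s | (j < J)%N)
     fejer (2 ^ j) (psi A (blk (fun i => l i) (fun i => zi (u i))) k).
have S0 l u : 0 <= S l u.
  rewrite mulr_ge0 ?wt_ge0 //; apply: prodr_ge0 => k _.
  by apply: sumr_ge0 => j _; exact: fejer_ge0.
have step2 lu : P lu -> 2 ^- sz (fun i => 2 * lu.1 i)%N * S lu.1 lu.2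
    <= D * recip e alpha (fun i => h lu i).
  move=> Plu; case: (lu) (Plu) (PE _ ^~ Plu) => l u Plu' PEl.
  have /andP[/= hQ _] := Plu'.
  have hz : nz (fun i => h (l, u) i) = blk (fun i => l i) (fun i => zi (u i)).
    by apply/funext => i; rewrite /nz; have [a _ _ _] := PEl i.
  pose l' : {ffun I -> 'I_N} := [ffun i => Ordinal (lN l i hQ)].
  have hbox : box (fun i => l' i) (h (l, u)).
    apply/andP; split.
      apply/existsP; exists ord0; have [_ b _ _] := PEl ord0.
      by rewrite -lt0n; apply: leq_trans b; rewrite expn_gt0.
    apply/forallP => i; have [_ _ b _] := PEl i.
    have -> : l' i = (2 * l i + 2).+1 :> nat by rewrite ffunE /= addnS.
    rewrite expnS leq_mul2l /=; apply: (leq_trans (ltnW b)).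
    by rewrite /= -[4%N]/(2 ^ 2)%N -expnM leq_exp2l //; lia.
  (* Positive distances are essential here: the inverse of a zero distance would be [0] and could
     not dominate the kernels. *)
  have [dpos _] := pointwise total_lt1 hbox.
  rewrite /S /recip -hz; set x := psi A _ in dpos *.
  apply: (@le_trans _ _ (2 ^- sz (fun i => 2 * l i)%N * \prod_k (24 / distZ (x k)))).
    rewrite ler_wpM2l ?invr_ge0 ?exprn_ge0 //.
    apply: (@le_trans _ _ (1 * \prod_k (24 / distZ (x k)))); last by rewrite mul1r.
    apply: ler_pM; rewrite ?wt_ge0 ?wt_le1 //.
      by apply: prodr_ge0 => k _; apply: sumr_ge0 => j _; exact: fejer_ge0.
    apply: ler_prod => k _; apply/andP; split.
      by apply: sumr_ge0 => j _; exact: fejer_ge0.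
    rewrite -(big_ord_widen _ (fun j => fejer (2 ^ j) (x k)) JB).
    exact: sum_fejer_le.
  rewrite big_split /= prodr_const card_ord prodfV invfM /D.
  rewrite [leRHS]mulrACA; apply: ler_wpM2r.
    rewrite mulr_ge0 ?exprn_ge0 // invr_ge0.
    by apply: prodr_ge0 => k _; exact: distZ_ge0.
  rewrite -prodr_exp2 -prodfV -prodfV -[X in 3 ^+ X]card_ord -prodr_const -big_split /=.
  apply: ler_prod => i _; rewrite invr_ge0 ler0n /=.
  have [_ b1 b2 b3] := PEl i.
  have four : (4 ^ l i = 2 ^ (2 * l i))%N by rewrite expnM.
  have hp : (0 < maxn 1 (h (l, u) i))%N by rewrite leq_max.
  rewrite ler_pdivlMr ?ltr0n // mulrC ler_pdivrMr ?ltr0n ?expn_gt0 // -natrM ler_nat.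
  rewrite geq_max muln_gt0 expn_gt0 /=.
  have /andP[_ /wt_gt0 hw] := Plu'.
  have [c1 c2 c3] := @blkP (fun i => l i) (fun i => zi (u i)) i (hw i).
  have [a _ _ _] := PEl i; rewrite /= in a c1 c3; lia.
have step3 : \sum_(l | Ql l) 2 ^- sz (fun i => 2 * l i)%N * \sum_u S l u
    <= D * gsum e alpha (2 ^ N) T.
  apply: (@le_trans _ _ (\sum_(lu | P lu) 2 ^- sz (fun i => 2 * lu.1 i)%N * S lu.1 lu.2)); last first.
    apply: (@le_trans _ _ (D * \sum_(lu | P lu) recip e alpha (fun i => h lu i))).
      by rewrite mulr_sumr; apply: ler_sum.
    by rewrite ler_wpM2l // ltW.
  rewrite -(pair_big_dep Ql (fun l u => 0 < wt R (L l) u)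
    (fun l u => 2 ^- sz (fun i => 2 * l i)%N * S l u)) /=.
  apply: ler_sum => l _; rewrite mulr_sumr [leRHS]big_mkcond; apply: ler_sum => u _.
  case: ifP => // /negbT; rewrite lt_def wt_ge0 andbT negbK => /eqP w0.
  by rewrite /S w0 mul0r mulr0.
have step4 l : Ql l -> J%:R ^+ r.+1 - block e s (fun i => 2 * l i)%N alpha
    <= 2 ^- sz (fun i => 2 * l i)%N * \sum_u S l u.
  move=> hQ.
  pose Qj (j : {ffun K -> 'I_(jbound p r s)}) := [forall k, (j k < J)%N].
  have jsz j : Qj j -> (sz (fun k => j k) <= sz (fun i => 2 * l i)%N)%N.
    move=> /forallP hj; apply: (@leq_trans (sz tau - p.+1)).
      apply: (@leq_trans (\sum_(k : K) ((sz tau - p.+1) %/ r.+1))).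
        by apply: leq_sum => k _; have := hj k; rewrite ltnS.
      by rewrite sum_nat_const card_ord mulnC leq_trunc_div.
    rewrite leq_subLR; apply: (@leq_trans (\sum_i (1 + 2 * l i))).
      by apply: leq_sum => i _; move/forallP: hQ => /(_ i) /andP[_]; rewrite addnC.
    by rewrite big_split /= sum1_card card_ord.
  have -> : \sum_u S l u = \sum_(j | Qj j) \sum_(u : {ffun I -> bool * 'I_NU}) wt R (L l) u *
      \prod_k fejer (2 ^ j k) (psi A (blk (fun i => l i) (fun i => zi (u i))) k).
    rewrite exchange_big /=; apply: eq_bigr => u _; rewrite /S -mulr_sumr; congr (_ * _).
    rewrite -(sum_ffun_prod (fun (k : K) (x : 'I_(jbound p r s)) => (x < J)%N)
       (fun k x => fejer (2 ^ x) (psi A (blk (fun i => l i) (fun i => zi (u i))) k))).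
    by [].
  have -> : J%:R ^+ r.+1 = \sum_(j | Qj j) 1 :> R.
    rewrite /Qj (sum_ffun_const R (fun (k : K) (x : 'I_(jbound p r s)) => (x < J)%N)).
    rewrite -[X in _ ^+ X]card_ord -prodr_const; apply: eq_bigr => k _.
    by rewrite -(big_ord_widen _ (fun=> 1) JB) sumr_const card_ord.
  apply: (@le_trans _ _ (\sum_(j | Qj j) (1 - term e s (fun i => 2 * l i)%N (fun k => j k) alpha))).
    rewrite sumrB lerD2l lerN2 /block [leLHS]big_mkcond [leRHS]big_mkcond.
    apply: ler_sum => j _; case: ifP => hj.
      by rewrite ifT // (leq_trans (jsz j hj)) // leq_addr.
    by case: ifP => _ //; exact: term_ge0.
  rewrite mulr_sumr; apply: ler_sum => j hj.
  have jb k : (0 < 2 ^ j k <= NU)%N by apply: pow_jbound; exact: ltnW.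
  have := sum_fejer_approx A (fun i => (2 * (2 ^ (2 * l i))%N - 1)%:Z) NU0 (fun i => LNU l i hQ) jb.
  rewrite ler_norml => /andP[hh _].
  rewrite /term ifT; last exact: jsz.
  rewrite ler_pdivlMl ?exprn_gt0 // mulrBr mulr1 mulrA mulfV ?expf_neq0 // mul1r.
  by move: hh; rewrite {2}/L prodr_exp2 lerBrDr addrC.
apply: le_trans step3.
apply: (@le_trans _ _ (\sum_(l | Ql l) (J%:R ^+ r.+1 - block e s (fun i => 2 * l i)%N alpha))); last first.
  by apply: ler_sum => l hl; exact: step4.
rewrite sumrB mulrBr lerB //.
  have -> : \sum_(l | Ql l) J%:R ^+ r.+1 = (\sum_(l | Ql l) 1) * J%:R ^+ r.+1 :> R.
    by rewrite mulr_suml; apply: eq_bigr => l _; rewrite mul1r.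
  rewrite mulrA; apply: ler_pM; rewrite ?mulr_ge0 ?invr_ge0 ?exprn_ge0 ?prodr_ge0 //.
  - rewrite /Ql (sum_ffun_const R (fun i (x : 'I_N) => (x < tau i)%N && (tau i <= 2 * x + 1)%N)).
    rewrite -exprVn -[X in _ ^+ X]card_ord -prodr_const -big_split /=; apply: ler_prod => i _.
    by rewrite divr_ge0 //= count_upper_half //; have := tauN i; lia.
  - apply: lerXn2r; rewrite ?nnegrE ?divr_ge0 //.
    by rewrite ler_pdivrMr ?ltr0n // -natrM ler_nat ltn_ceil.
(* The windows have order [4 ^ l i], so the blocks involved are those of [2 * l i], which is below
   [2 * tau i]. *)
apply: (@le_trans _ _ (\sum_(l : {ffun I -> 'I_N} | [forall i, (l i < 2 * tau i)%N]) block e s (fun i => l i) alpha)).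
  have hE l : Ql l -> forall i, insubd (l i) (2 * l i)%N = (2 * l i)%N :> nat.
    by move=> hQ i; rewrite val_insubd ifT //; have := lN l i hQ; lia.
  apply: (@ler_sum_inj R _ _ _ _ _ _ (fun l : {ffun I -> 'I_N} => [ffun i => insubd (l i) (2 * l i)%N])).
  - move=> l l'; rewrite !unfold_in => hl hl' /ffunP eql; apply/ffunP => i; apply: val_inj => /=.
    by have := eql i; rewrite !ffunE => /(congr1 val) /=; rewrite !hE //; lia.
  - move=> l hl; apply/forallP => i; rewrite ffunE hE //.
    by move/forallP: hl => /(_ i) /andP[]; lia.
  - move=> l hl; rewrite le_eqVlt; apply/orP; left; apply/eqP; congr block.
    by apply/funext => i; rewrite ffunE hE.
  - by move=> l _; exact: block_ge0.
rewrite [leRHS]mulrA; apply: (blocks_le total_lt1).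
  by rewrite mulr_ge0 ?exprn_ge0 ?prodr_ge0.
move=> l /forallP hl; rewrite mulrC -[X in _ ^+ X]card_ord -prodr_const -big_split /=.
apply: ler_prod => i _; rewrite addr_ge0 //= nat1r -natrM ler_nat; exact: hl.
Qed.
End Lower.

(** * Both bounds at a level adapted to [T] *)

Section Asymptotics.
Variables (R : realType) (n p r : nat) (e : 'I_p.+1 -> 'I_r.+1 -> 'I_n).
Local Notation I := 'I_p.+1.
Local Notation K := 'I_r.+1.

Definition logs (T : I -> nat) : R :=
  (1 + sz (fun i => trunc_log 2 (T i)))%:R ^+ r.+1 * \prod_i (1 + trunc_log 2 (T i))%:R.

Section Fixed.
Variables (alpha : 'I_n -> R) (s0 : nat).
Hypothesis total_lt1 : forall s, (s0 <= s)%N -> total e s alpha < 1.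

(** The single term [q = (1, ..., 1)] suffices, as its distances lie in [(0, 1 / 2]]. This settles
    the lower bound for small [T], where deviations may exceed the main term. *)
Lemma gsum_ge1 (s : nat) (T : I -> nat) : (0 < s)%N -> (s0 <= s)%N ->
  (forall i, 0 < T i)%N -> 1 <= gsum e alpha (2 ^ nscale s) T.
Proof.
move=> sp ss0 T0.
have N1 : (1 < nscale s)%N by rewrite -(expn0 4) ltn_exp2l.
pose q : {ffun I -> 'I_(2 ^ nscale s).+1} := [ffun=> inord 1].
have qE i : q i = 1%N :> nat by rewrite ffunE inordK // ltnS expn_gt0.
pose l : {ffun I -> 'I_(nscale s)} := [ffun=> Ordinal N1].
have hb : box (fun i => l i) q.
  apply/andP; split; first by apply/existsP; exists ord0; rewrite qE.
  by apply/forallP => i; rewrite qE ffunE.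
have [dpos _] := pointwise (total_lt1 ss0) hb.
rewrite /gsum (bigD1 q) /=; last first.
  apply/andP; split; first by apply/existsP; exists ord0; rewrite qE.
  by apply/forallP => i; rewrite qE.
apply: (@le_trans _ _ (recip e alpha (fun i => q i))); last first.
  by rewrite lerDl sumr_ge0 // => q' _; exact: recip_ge0.
rewrite /recip big1 => [|i _]; last by rewrite qE.
rewrite mul1r invf_ge1; last by apply: prodr_gt0 => k _.
apply: prodr_ile1 => k _; rewrite distZ_ge0 /=.
by have /andP[_ h] := distZ_itv (psi (mx e alpha) (nz (fun i => q i)) k); apply: (le_trans h); lra.
Qed.

(** The level [s = s0 + s1] is chosen with [4 ^ s1] comparable to [X = 1 + sz t], so that [N] is
    comparable to [X]. Deviations then have size [N ^ r.+1 / 2 ^ s] against a main term of size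
    [X ^ r.+1], which gives the upper bound always and the lower bound when [s1 >= m]. For [s1 < m]
    the vector [T] is bounded and [gsum_ge1] is enough. *)
Lemma gsum_asymp_fixed : exists C : R, 0 < C /\
  forall Q (T : I -> nat), (forall i, 0 < T i <= Q)%N ->
    gsum e alpha Q T <= C * logs T /\ logs T <= C * gsum e alpha Q T.
Proof.
(* From [4 ^ s1 <= 4 * (sz t + 2)] and [sz t + 2 <= 2 * X] it will follow that [N <= E * X]. *)
pose E : R := 4 ^+ s0.+1 * 2.
have E1 : 1 <= E.
  have : 1 <= 4 ^+ s0.+1 :> R by rewrite exprn_ege1 // ler1n.
  by rewrite /E; lra.
pose c0 : R := 4 ^+ p.+1 * 32 ^+ r.+1 * 2 ^+ p.+1.
have c00 : 0 <= c0 by rewrite !mulr_ge0 ?exprn_ge0.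
pose C1 : R := c0 * (3 ^+ p.+1 * ((2 * p.+1).+1%:R ^+ r.+1 + E ^+ r.+1)).
have C10 : 0 <= C1.
  by rewrite mulr_ge0 // mulr_ge0 ?exprn_ge0 // addr_ge0 ?exprn_ge0 //; lra.
(* [kap * X ^ r.+1] bounds from below the main term of [gsum_lower]. Of the [3 * p.+1], one [p.+1]
   is the rounding in [tau] and two come from the [p.+1] subtracted from [sz tau]. *)
pose kap : R := 2 ^- p.+1 * (((3 * p.+1).+1%:R * r.+1%:R)^-1) ^+ r.+1.
have kap0 : 0 < kap.
  by rewrite mulr_gt0 ?invr_gt0 ?exprn_gt0 ?invr_gt0 ?mulr_gt0 ?ltr0n.
pose D : R := 3 ^+ p.+1 * 24 ^+ r.+1.
have D0 : 0 <= D by rewrite mulr_ge0 ?exprn_ge0.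
pose C2 : R := 2 * 4 ^+ p.+1 * D / kap.
have C20 : 0 <= C2 by rewrite mulr_ge0 ?invr_ge0 ?(ltW kap0) // !mulr_ge0 ?exprn_ge0.
(* From level [m] on, deviations are at most half of the main term. *)
pose m := (Num.truncn (2 * 2 ^+ p.+1 * E ^+ r.+1 / kap)).+1.
have hm : 2 * (2 ^+ p.+1 * E ^+ r.+1) <= kap * 2 ^+ m.
  have : 2 * 2 ^+ p.+1 * E ^+ r.+1 / kap < m%:R by exact: truncnS_gt.
  rewrite ltr_pdivrMr // mulrA => h; apply/ltW; apply: (lt_le_trans h).
  by rewrite mulrC ler_wpM2l ?(ltW kap0) // -natrX ler_nat ltnW // ltn_expl.
pose C3 : R := (4 ^ m)%:R ^+ (r.+1 + p.+1).
have C30 : 0 < C3 by rewrite exprn_gt0 // ltr0n expn_gt0.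
exists (C1 + C2 + C3); split; first by rewrite ltr_wpDl ?addr_ge0.
move=> Q T TQ.
pose t i := trunc_log 2 (T i).
have T0 i : (0 < T i)%N by have /andP[] := TQ i.
have Tt i : (T i < 2 ^ (t i).+1)%N by exact: trunc_log_ltn.
have tT i : (2 ^ t i <= T i)%N by exact: trunc_logP.
have tsz i : (t i <= sz t)%N by rewrite /sz (bigD1 i) //= leq_addr.
pose s1 := (trunc_log 4 (sz t + 2)).+1.
have s1a : (sz t + 2 < 4 ^ s1)%N by exact: trunc_log_ltn.
have s1b : (4 ^ s1 <= 4 * (sz t + 2))%N by rewrite expnS leq_mul2l trunc_logP // addn2.
pose s := (s0 + s1)%N.
have Hs : total e s alpha < 1 by apply: total_lt1; exact: leq_addr.
pose N := nscale s.
have N1 : (4 ^ s1 <= N)%N by rewrite /N /nscale leq_exp2l // leq_addl.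
pose X : R := (1 + sz t)%:R.
have X0 : 0 <= X by exact: ler0n.
have NX : N%:R <= E * X.
  apply: (@le_trans _ _ ((4 ^ s0 * (4 * (sz t + 2)))%N%:R)).
    by rewrite ler_nat /N /nscale expnD leq_mul2l s1b orbT.
  have -> : E * X = (4 ^ s0.+1 * 2 * (1 + sz t))%N%:R by rewrite !natrM natrX.
  by rewrite ler_nat expnS; move: (4 ^ s0)%N (sz t) => y z; clear; nia.
have TN i : (T i <= 2 ^ N)%N.
  apply: (leq_trans (ltnW (Tt i))); rewrite leq_exp2l //.
  by apply: leq_trans N1; apply: leq_trans s1a; rewrite ltnS (leq_trans (tsz i)) ?leq_addr.
have tN i : ((t i).+2 < N)%N.
  by apply: leq_trans N1; apply: leq_trans s1a; rewrite addn2 !ltnS.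
have gE : gsum e alpha Q T = gsum e alpha (2 ^ N) T.
  apply/eqP; rewrite eq_le !gsum_widen //.
  by move=> i; have /andP[] := TQ i.
have Y0 : 0 <= logs T by rewrite mulr_ge0 ?exprn_ge0 // prodr_ge0.
have g1 : 1 <= gsum e alpha (2 ^ N) T.
  by apply: gsum_ge1 => //; rewrite ?leq_addr // /s addnS.
have Pt0 : 0 <= \prod_i (1 + t i)%:R :> R by apply: prodr_ge0.
have N2 : N%:R = 2 ^+ s * 2 ^+ s :> R.
  by rewrite /N /nscale natrX -exprMn; congr (_ ^+ _); ring.
have p2 k : 0 < 2 ^+ k :> R by rewrite exprn_gt0.
have N0 : 0 <= N%:R :> R by exact: ler0n.
rewrite gE; split.
  apply: (@le_trans _ _ (C1 * logs T)); last by rewrite ler_wpM2r // -addrA lerDl addr_ge0 // ltW.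
  apply: (le_trans (gsum_upper Hs Tt tN)).
  rewrite -/c0 /C1 -mulrA ler_wpM2l // /logs -/t -/X [X ^+ _ * _]mulrC mulrACA.
  apply: ler_pM.
  - by apply: prodr_ge0.
  - by rewrite addr_ge0 ?exprn_ge0 // mulr_ge0 ?exprn_ge0.
  - rewrite -[X in _ ^+ X]card_ord -prodr_const -big_split /=.
    by apply: ler_prod => i _; rewrite ler0n /= -natrM ler_nat -/(t i); clear; lia.
  - rewrite mulrDl -!exprMn lerD //.
      apply: lerXn2r; rewrite ?nnegrE ?mulr_ge0 //.
      by rewrite -natrM ler_nat; move: (sz t) => z; clear; nia.
    apply: (@le_trans _ _ (N%:R ^+ r.+1)).
      rewrite exprSr ler_wpM2l ?exprn_ge0 // N2 ler_peMl ?exprn_ge0 // exprn_ege1 //.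
      by rewrite ler1n.
    by apply: lerXn2r; rewrite ?nnegrE ?mulr_ge0 //; lra.
case: (leqP m s1) => hs; last first.
  apply: (@le_trans _ _ (C3 * gsum e alpha (2 ^ N) T)); last first.
    by rewrite ler_wpM2r ?(le_trans _ g1) // lerDr addr_ge0.
  apply: (@le_trans _ _ (C3 * 1)); last by rewrite ler_wpM2l // ltW.
  rewrite mulr1 /C3 exprD /logs -/t.
  have h4 : (sz t + 2 < 4 ^ m)%N by apply: leq_trans s1a _; rewrite leq_exp2l // ltnW.
  apply: ler_pM; rewrite ?exprn_ge0 //.
    by apply: lerXn2r; rewrite ?nnegrE // ler_nat -/t; move: h4; clear; lia.
  rewrite -[X in _ <= _ ^+ X]card_ord -prodr_const; apply: ler_prod => i _.
  by rewrite ler0n /= ler_nat -/(t i); move: h4 (tsz i); clear; lia.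
apply: (@le_trans _ _ (C2 * gsum e alpha (2 ^ N) T)); last first.
  rewrite ler_wpM2r ?(le_trans _ g1) //.
  by rewrite [C1 + C2]addrC -addrA lerDl addr_ge0 // ltW.
(* [l < (t i)./2] gives [3 * 4 ^ l <= 2 ^ t i <= T i]. The value [1] is always admissible, because
   the window for [l = 0] is the single point [1]. *)
pose tau i := maxn 1 (t i)./2.
have th i := odd_double_half (t i).
have low := @gsum_lower R n p r e s alpha Hs T tau.
have {low} low := low _ _ _ TN.
have {low} low : \prod_i (tau i)%:R * (2 ^- p.+1 * ((sz tau - p.+1).+1%:R / r.+1%:R) ^+ r.+1
     - 2 ^+ p.+1 * (N%:R ^+ r * 2 ^+ s)) <= D * gsum e alpha (2 ^ N) T.
  apply: low.
  - by move=> i; rewrite leq_max.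
  - move=> i; rewrite /tau -/N; apply: leq_trans N1; have := tsz i; have := th i.
    have : (4 <= 4 ^ s1)%N by rewrite expnS leq_pmulr // expn_gt0.
    by move: s1a; clear; lia.
  - move=> i l; rewrite /tau; case: (posnP l) => [->|l0] hl; first by have := T0 i; move: hl; clear; lia.
    apply: leq_trans (tT i); apply: (@leq_trans (2 ^ (2 * l + 2))).
      rewrite expnD expnM -[(2 ^ 2)%N]/4%N; move: (4 ^ l)%N => y; clear; lia.
    by rewrite leq_exp2l //; have := th i; move: l0 hl; clear; lia.
have bra : kap * X ^+ r.+1 / 2 <= 2 ^- p.+1 * ((sz tau - p.+1).+1%:R / r.+1%:R) ^+ r.+1
     - 2 ^+ p.+1 * (N%:R ^+ r * 2 ^+ s).
  have b1 : kap * X ^+ r.+1 <= 2 ^- p.+1 * ((sz tau - p.+1).+1%:R / r.+1%:R) ^+ r.+1.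
    rewrite /kap -mulrA ler_wpM2l ?invr_ge0 ?(ltW (p2 _)) // -exprMn.
    apply: lerXn2r; rewrite ?nnegrE ?mulr_ge0 ?invr_ge0 ?mulr_ge0 ?ler0n //.
    rewrite invfM mulrAC ler_wpM2r ?invr_ge0 ?ler0n // mulrC ler_pdivrMr ?ltr0n //.
    rewrite -natrM ler_nat.
    have : (sz t <= 2 * (sz tau - p.+1) + 3 * p.+1)%N.
      have : (\sum_(i < p.+1) (t i + 2) <= \sum_(i < p.+1) (2 * tau i + 3))%N.
        by apply: leq_sum => i _; rewrite /tau; have := th i; clear; lia.
      have : (\sum_(i < p.+1) 1 <= sz tau)%N by apply: leq_sum => i _; rewrite leq_max.
      have -> : (\sum_(i < p.+1) (2 * tau i + 3) = 2 * sz tau + p.+1 * 3)%N.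
        by rewrite big_split /= sum_nat_const card_ord /sz big_distrr.
      rewrite big_split /= !sum_nat_const card_ord -/(sz t); move: (sz t) (sz tau); clear; lia.
    by move: (sz tau - p.+1)%N => y; clear; nia.
  have b2 : 2 ^+ p.+1 * (N%:R ^+ r * 2 ^+ s) <= kap * X ^+ r.+1 / 2.
    have e1 : N%:R ^+ r * 2 ^+ s * 2 ^+ s <= E ^+ r.+1 * X ^+ r.+1.
      rewrite -mulrA -N2 -exprSr -exprMn; apply: lerXn2r; rewrite ?nnegrE ?mulr_ge0 //; lra.
    have e2 : 2 ^+ m <= 2 ^+ s :> R by rewrite ler_weXn2l ?ler1n // (leq_trans hs) // leq_addl.
    rewrite ler_pdivlMr // -(ler_pM2r (p2 s)).
    apply: (@le_trans _ _ (2 * (2 ^+ p.+1 * E ^+ r.+1) * X ^+ r.+1)).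
      have := ler_wpM2l (ltW (p2 p.+1)) e1; lra.
    apply: (@le_trans _ _ (kap * 2 ^+ m * X ^+ r.+1)); first by rewrite ler_wpM2r ?exprn_ge0.
    rewrite mulrAC ler_wpM2l // mulr_ge0 ?(ltW kap0) ?exprn_ge0 //.
  lra.
have tau4 : \prod_i (1 + t i)%:R <= 4 ^+ p.+1 * \prod_i (tau i)%:R :> R.
  rewrite -[X in _ ^+ X]card_ord -prodr_const -big_split /=; apply: ler_prod => i _.
  by rewrite ler0n /= -natrM ler_nat /tau; have := th i; clear; lia.
have tau0 : 0 <= \prod_i (tau i)%:R :> R by apply: prodr_ge0.
rewrite /C2 mulrAC ler_pdivlMr // /logs -/t -/X.
apply: (@le_trans _ _ (2 * 4 ^+ p.+1 * (\prod_i (tau i)%:R * (kap * X ^+ r.+1 / 2)))).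
  have : X ^+ r.+1 * kap * \prod_i (1 + t i)%:R
     <= X ^+ r.+1 * kap * (4 ^+ p.+1 * \prod_i (tau i)%:R).
    by rewrite ler_wpM2l // mulr_ge0 ?exprn_ge0 // ltW.
  lra.
rewrite -[leRHS]mulrA ler_wpM2l ?mulr_ge0 ?exprn_ge0 //.
by apply: le_trans low; rewrite ler_wpM2l.
Qed.
End Fixed.

Lemma ae_mono (P Q : ('I_n -> R) -> Prop) : (forall x, P x -> Q x) -> ae_Rn P -> ae_Rn Q.
Proof.
move=> PQ aeP eps /aeP[a [b [h1 [h2 h3]]]]; exists a, b; split; [|split] => // x /= nQ.
by apply: h2 => Px; apply: nQ; exact: PQ.
Qed.

Lemma ae_gsum_asymp (ei : 'I_n -> I) (ek : 'I_n -> K) :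
  (forall x, e (ei x) (ek x) = x) -> (forall i k, ei (e i k) = i) ->
  (forall i k, ek (e i k) = k) -> (0 < n)%N ->
  ae_Rn (fun alpha => exists C : R, 0 < C /\
    forall Q (T : I -> nat), (forall i, 0 < T i <= Q)%N ->
      gsum e alpha Q T <= C * logs T /\ logs T <= C * gsum e alpha Q T).
Proof.
move=> eK eiK ekK n0; have H := @ae_total_lt1 R _ _ _ _ _ _ eK eiK ekK n0.
apply: (ae_mono _ H) => alpha [s0 h].
exact: gsum_asymp_fixed h.
Qed.
End Asymptotics.

(** * The two sums *)

Section Logarithms.
Variable R : realType.
Implicit Types (x T : R).

Lemma ln2_gt0 : 0 < ln 2 :> R.
Proof. by rewrite ln_gt0 // ltr1n. Qed.

Lemma ln2_le1 : ln 2 <= 1 :> R.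
Proof.
rewrite -[leRHS](@expRK R) ler_ln ?posrE ?expR_gt0 //.
by apply: le_trans (expR_ge1Dx 1); lra.
Qed.

Lemma ln_exp2 k : ln (2 ^+ k) = k%:R * ln 2 :> R.
Proof. by rewrite lnXn // mulr_natl. Qed.

Lemma logmE x : 0 < x -> logm x = Num.max (ln x) 1.
Proof.
move=> x0; rewrite /logm; case: (leP x (expR 1)) => h.
  by rewrite expRK max_r // -[leRHS](@expRK R) ler_ln ?posrE ?expR_gt0.
by rewrite max_l // -[leLHS](@expRK R) ler_ln ?posrE ?expR_gt0 // ltW.
Qed.

(* [x] stands for the geometric mean of [m] numbers whose dyadic logarithms sum to [k]. *)
Lemma logm_comparison (m k : nat) x y : (0 < m)%N -> 0 < x -> ln x = m%:R^-1 * ln y ->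
  2 ^+ k <= y -> y <= 2 ^+ (k + m) ->
  (1 + k)%:R <= (1 + m%:R / ln 2) * logm x /\ logm x <= (1 + k)%:R.
Proof.
move=> m0 x0 lnx yk ykm.
have y0 : 0 < y by apply: lt_le_trans yk; rewrite exprn_gt0.
have l2 := ln2_gt0; have l1 := ln2_le1.
have mp : 0 < m%:R :> R by rewrite ltr0n.
have m1 : 1 <= m%:R :> R by rewrite ler1n.
have lk : k%:R * ln 2 <= ln y by rewrite -ln_exp2 ler_ln ?posrE // exprn_gt0.
have lkm : ln y <= (k + m)%:R * ln 2 by rewrite -ln_exp2 ler_ln ?posrE // exprn_gt0.
have k0 : 0 <= k%:R :> R by exact: ler0n.
have le1 : 1 <= logm x by rewrite logmE // le_max lexx orbT.
have leln : ln x <= logm x by rewrite logmE // le_max lexx.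
split.
  rewrite natrD mulrDl mul1r lerD // mulrAC ler_pdivlMr //.
  apply: (le_trans lk); rewrite -ler_pdivrMl // -lnx //.
rewrite logmE // ge_max; apply/andP; split; last by rewrite natrD lerDl.
rewrite lnx ler_pdivrMl //; apply: (le_trans lkm).
apply: (@le_trans _ _ ((k + m)%:R * 1)); first by rewrite ler_wpM2l.
by rewrite mulr1 -natrM ler_nat; nia.
Qed.

Lemma truncn_log_bounds T : 1 <= T ->
  2 ^+ trunc_log 2 (Num.truncn T) <= T /\ T <= 2 ^+ (trunc_log 2 (Num.truncn T)).+1.
Proof.
move=> T1; have T0 : 0 <= T by apply: le_trans T1.
have tp : (0 < Num.truncn T)%N by rewrite truncn_gt0.
have /andP[h1 h2] := truncn_itv T0; split.
  by apply: le_trans h1; rewrite -natrX ler_nat trunc_logP.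
by apply: (le_trans (ltW h2)); rewrite -natrX ler_nat trunc_log_ltn.
Qed.

Lemma logm_trunc_log T : 1 <= T ->
  (1 + trunc_log 2 (Num.truncn T))%:R <= (1 + (ln 2)^-1) * logm T
  /\ logm T <= (1 + trunc_log 2 (Num.truncn T))%:R.
Proof.
move=> T1; have [h1 h2] := truncn_log_bounds T1.
rewrite -[(ln 2)^-1]mul1r; apply: (@logm_comparison 1 _ T T) => //.
- exact: lt_le_trans T1.
- by rewrite invr1 mul1r.
- by rewrite addn1.
Qed.

Lemma logm_ge0 x : 0 <= logm x.
Proof.
by rewrite /logm ln_ge0 // le_max; apply/orP; right; apply: le_trans (expR_ge1Dx 1); lra.
Qed.

Lemma pos1_nat (q : nat) : pos1 (q%:R : R) = (maxn 1 q)%:R.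
Proof. by rewrite /pos1 natr_max. Qed.
End Logarithms.

(** * Reduction of the two sums to the general one *)

Section Transfer.
Variables (R : realType) (n : nat).

Definition row_index (i : 'I_n.+1) (k : 'I_1) : 'I_n.+1 := i.
Definition col_index (i : 'I_1) (k : 'I_n.+1) : 'I_n.+1 := k.

Lemma Ssum_gsum (alpha T : 'I_n.+1 -> R) : (forall i, 1 <= T i) ->
  Ssum alpha T = gsum row_index alpha (\max_i Num.truncn (T i))
                   (fun i => Num.truncn (T i)).
Proof.
move=> T1; rewrite /Ssum /gsum; apply: eq_big => [q|q _].
  congr (_ && _); apply: eq_forallb => i; rewrite truncn_ge_nat //.
  by apply: le_trans (T1 i).
rewrite /recip big_ord1 div1r; congr ((_ * distZ _)^-1).
by apply: eq_bigr => i _; exact: pos1_nat.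
Qed.

Lemma Sstar_gsum (alpha : 'I_n.+1 -> R) (T : R) :
  Sstar alpha T = gsum col_index alpha (Num.truncn T) (fun=> Num.truncn T).
Proof.
rewrite /Sstar /gsum big_geq_mkord.
rewrite [RHS](reindex (fun x : 'I_(Num.truncn T).+1 => [ffun=> x] : {ffun 'I_1 -> 'I_(Num.truncn T).+1})) /=; last first.
  exists (fun q => q ord0) => [x _|q _]; first by rewrite ffunE.
  by apply/ffunP => i; rewrite ffunE (ord1 i).
apply: eq_big => [x|x x1].
  symmetry; apply/andP/idP => [[/existsP[i hi] _]|x1].
    by move: hi; rewrite ffunE lt0n.
  split; first by apply/existsP; exists ord0; rewrite ffunE -lt0n.
  by apply/forallP => i; rewrite ffunE -ltnS.
rewrite /recip big_ord1 ffunE (maxn_idPr x1) div1r; congr ((_ * _)^-1).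
apply: eq_bigr => k _; congr distZ.
by rewrite /psi big_ord1 /nz ffunE.
Qed.

Lemma logs_row (T : 'I_n.+1 -> R) : (forall i, 1 <= T i) ->
  let Y := logm (powR (\prod_i T i) (n.+1%:R^-1)) * \prod_i logm (T i) in
  let Z := logs R 0 (fun i => Num.truncn (T i)) in
  Z <= (1 + n.+1%:R / ln 2) * (1 + (ln 2)^-1) ^+ n.+1 * Y /\ Y <= Z.
Proof.
move=> T1 Y Z; rewrite /Y /Z /logs expr1 {Y Z}.
set t := sz _; set x := powR _ _.
have T0 i : 0 < T i by exact: lt_le_trans (T1 i).
have P0 : 0 < \prod_i T i by apply: prodr_gt0.
have l2 := ln2_gt0 R.
have [a1 a2] : (1 + t)%:R <= (1 + n.+1%:R / ln 2) * logm x /\ logm x <= (1 + t)%:R.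
  apply: (@logm_comparison R n.+1 t x (\prod_i T i)) => //.
  - exact: powR_gt0.
  - by rewrite /x ln_powR.
  - rewrite -prodr_exp2; apply: ler_prod => i _; rewrite ler0n natrX /=.
    by have [] := truncn_log_bounds (T1 i).
  - have -> : (t + n.+1 = \sum_(i < n.+1) (trunc_log 2 (Num.truncn (T i))).+1)%N.
      rewrite (eq_bigr (fun i => trunc_log 2 (Num.truncn (T i)) + 1)%N) => [|i _]; last by rewrite addn1.
      by rewrite big_split /= sum1_card card_ord.
    rewrite -prodr_exp2; apply: ler_prod => i _; rewrite natrX (ltW (T0 i)) /=.
    by have [] := truncn_log_bounds (T1 i).
split.
  rewrite mulrACA; apply: ler_pM => //; first by apply: prodr_ge0.
  rewrite -[X in _ <= _ ^+ X * _]card_ord -prodr_const -big_split /=.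
  by apply: ler_prod => i _; rewrite ler0n; have [] := logm_trunc_log (T1 i).
apply: ler_pM; rewrite ?logm_ge0 //; first by apply: prodr_ge0 => i _; exact: logm_ge0.
by apply: ler_prod => i _; rewrite logm_ge0; have [] := logm_trunc_log (T1 i).
Qed.

Lemma logs_col (T : R) : 1 <= T ->
  logs R n (fun _ : 'I_1 => Num.truncn T) <= (1 + (ln 2)^-1) ^+ n.+2 * logm T ^+ n.+2
  /\ logm T ^+ n.+2 <= logs R n (fun _ : 'I_1 => Num.truncn T).
Proof.
move=> T1; have l2 := ln2_gt0 R.
rewrite /logs /sz !big_ord1 -exprSr -exprMn.
have [h1 h2] := logm_trunc_log T1.
split; apply: lerXn2r; rewrite ?nnegrE ?logm_ge0 //.
by rewrite mulr_ge0 ?logm_ge0 // addr_ge0 // invr_ge0 ltW.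
Qed.

Lemma asymp_of_bounds (S Y Z C D : R) : 0 < C -> 1 <= D -> 0 <= S -> 0 <= Y ->
  S <= C * Z -> Z <= C * S -> Z <= D * Y -> Y <= Z -> S <= C * D * Y /\ Y <= C * D * S.
Proof.
move=> C0 D1 S0 Y0 h1 h2 h3 h4; split.
  by rewrite -mulrA; apply: (le_trans h1); rewrite ler_pM2l.
apply: (le_trans h4); apply: (le_trans h2).
by rewrite ler_wpM2r // ler_peMr // ltW.
Qed.
End Transfer.

Theorem mainTheorem2 (R : realType) (n : nat) : (1 <= n)%N ->
  ae_Rn (fun alpha : 'I_n -> R =>
    asymp_unif (fun T : 'I_n -> R => forall i, 1 <= T i)
      (fun T => Ssum alpha T)
      (fun T => logm (powR (\prod_(i < n) T i) (n%:R^-1))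
                * \prod_(i < n) logm (T i)))
  /\
  ae_Rn (fun alpha : 'I_n -> R =>
    asymp_unif (fun T : R => 1 <= T)
      (fun T => Sstar alpha T)
      (fun T => logm T ^+ n.+1)).
Proof.
case: n => [//|n] _; have l2 := ln2_gt0 R; split.
  have H := @ae_gsum_asymp R _ _ _ (@row_index n) id (fun=> ord0) (fun=> erefl)
    (fun _ _ => erefl) (fun i k => esym (ord1 k)) isT.
  apply: (ae_mono _ H) => alpha [C [C0 hC]].
  exists (C * ((1 + n.+1%:R / ln 2) * (1 + (ln 2)^-1) ^+ n.+1)).
  have D1 : 1 <= (1 + n.+1%:R / ln 2) * (1 + (ln 2)^-1) ^+ n.+1 :> R.
    apply: mulr_ege1; first by rewrite lerDl divr_ge0 // ltW.
    by rewrite exprn_ege1 // lerDl invr_ge0 ltW.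
  split; first by rewrite mulr_gt0 // (lt_le_trans ltr01).
  move=> T T1; rewrite Ssum_gsum //.
  have [|h1 h2] := hC (\max_i Num.truncn (T i)) (fun i => Num.truncn (T i)).
    by move=> i; rewrite truncn_gt0 T1 /=; exact: (leq_bigmax i).
  have [h3 h4] := logs_row T1.
  apply: (asymp_of_bounds C0 D1 _ _ h1 h2 h3 h4).
    by apply: sumr_ge0 => q _; exact: recip_ge0.
  by rewrite mulr_ge0 ?logm_ge0 // prodr_ge0 // => i _; exact: logm_ge0.
have H := @ae_gsum_asymp R _ _ _ (@col_index n) (fun=> ord0) id (fun=> erefl)
  (fun i k => esym (ord1 i)) (fun _ _ => erefl) isT.
apply: (ae_mono _ H) => alpha [C [C0 hC]].
exists (C * (1 + (ln 2)^-1) ^+ n.+2).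
have D1 : 1 <= (1 + (ln 2)^-1) ^+ n.+2 :> R.
  by rewrite exprn_ege1 // lerDl invr_ge0 ltW.
split; first by rewrite mulr_gt0 // (lt_le_trans ltr01).
move=> T T1; rewrite Sstar_gsum.
have [|h1 h2] := hC (Num.truncn T) (fun=> Num.truncn T).
  by move=> i; rewrite truncn_gt0 T1 /=.
have [h3 h4] := logs_col n T1.
apply: (asymp_of_bounds C0 D1 _ _ h1 h2 h3 h4).
  by apply: sumr_ge0 => q _; exact: recip_ge0.
by rewrite exprn_ge0 // logm_ge0.
Qed.
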